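(* Let $k=2m+1>l=2h\ge 0$ be integers ($k$ odd, $l$ even) and $N>2k$. Then there exist $k$ positive constants $C_{k,l}^i$ ($i=1,\dots,k$) such that for all $u\in C_c^\infty(\mathbb{H}^N\setminus\{o\})$ $$\int_{\mathbb{H}^N}|\nabla_r(\Delta_r^m u)|^2\,dv_{\mathbb{H}^N}-\Big(\frac{N-1}{2}\Big)^{4(m-h)+2}\int_{\mathbb{H}^N}(\Delta_r^h u)^2\,dv_{\mathbb{H}^N}\ \ge\ \sum_{i=1}^{k}C_{k,l}^i\int_{\mathbb{H}^N}\frac{u^2}{r^{2i}}\,dv_{\mathbb{H}^N},$$ where $C_{k,l}^k=C_{k-l,0}^{k-l}\,\Xi_{2(k-l),\,l/2}^{0}$ and $C_{k,l}^1=C_{k-l,0}^{1}\,\Xi_{2,\,l/2}^{l}$, with the quantities $C_{n,0}^{n}$, $C_{n,0}^{1}$, $\Xi_{\alpha,\beta}^{0}$, $\Xi_{\alpha,\beta}^{2\beta}$ given by the explicit formulas in the context.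
   Context: $\mathbb{H}^N$ is the $N$-dimensional hyperbolic space with a fixed pole $o$. In geodesic polar coordinates $x=(r,\sigma)\in(0,\infty)\times\mathbb{S}^{N-1}$ about $o$, with $r$ the geodesic distance from $x$ to $o$, the metric is $dr^2+\sinh^2 r\,d\omega^2$ and $dv_{\mathbb{H}^N}=(\sinh r)^{N-1}\,dr\,d\sigma$ is the volume element. The radial gradient is $\nabla_r u=(\frac{\partial u}{\partial r},0)$, so $|\nabla_r u|^2=(\frac{\partial u}{\partial r})^2$; the radial Laplacian is $\Delta_r u=\frac{\partial^2u}{\partial r^2}+(N-1)\coth r\,\frac{\partial u}{\partial r}$, and $\Delta_r^j$ is its $j$-th iterate ($\Delta_r^0u=u$). The constants depend only on $N,k,l,i$, not on $u$. Explicit quantities (empty sums are $0$, empty products are $1$). For a positive integer $n$: $$C_{n,0}^n=\begin{cases}\big(\frac{N-4}{2^{2p}}\big)^2\prod_{j=1}^{p-1}(N+4j)^2(N-4j-4)^2 & n=2p,\\ \frac{1}{2^{4p+2}}\prod_{j=1}^{p}(N+4j-2)^2(N-4j-2)^2 & n=2p+1,\end{cases}$$ $$C_{n,0}^1=\begin{cases}\frac{N(N-1)}{2^{4p}}\sum_{j=1}^{p}(N-1)^{4p-2j-2} & n=2p,\\ \frac{N(N-1)}{2^{4p+2}}\sum_{j=1}^{p}(N-1)^{2p+2j-2}+\frac{(N-1)^{2p}}{2^{4p+2}} & n=2p+1.\end{cases}$$ For $\alpha\ge0$ and an integer $\beta\ge1$: $$\Xi_{\alpha,\beta}^0=\prod_{j=0}^{\beta-1}\frac{(N+\alpha+4j)^2(N-\alpha-4j-4)^2}{16},\qquad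 \Xi_{\alpha,\beta}^{2\beta}=\Big(\frac{N-1}{4}\Big)^{2\beta},$$ and $\Xi_{\alpha,0}^0=1$. *)

(* Defs.v *)
From HB Require Import structures.
From mathcomp Require Import all_boot all_order all_algebra.
From mathcomp Require Import all_classical all_reals all_analysis.
From mathcomp Require Import measurable_realfun.

Set Implicit Arguments.
Unset Strict Implicit.
Unset Printing Implicit Defensive.

Import Order.TTheory GRing.Theory Num.Theory.
Import numFieldNormedType.Exports.

Local Open Scope classical_set_scope.
Local Open Scope ring_scope.

(* The hyperbolic space H^N is R^N (row vectors) in geodesic normal
   coordinates about the pole o = 0, i.e. with the metric
   dr^2 + sinh^2 r dw^2: the vector r *: w, with r > 0 and |w| = 1, is the
   point with geodesic polar coordinates (r, w). The exponential map at o is a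
   diffeomorphism, so smoothness and compactness on H^N are those of R^N. *)

Section Calculus.
Context {R : realType} {N : nat}.
Implicit Types (u : 'rV[R]_N -> R) (x : 'rV[R]_N).

(* Geodesic distance to o; `|x| is the sup norm on matrices. *)
Definition polar_radius x : R := Num.sqrt (\sum_(i < N) x ord0 i ^+ 2).

Definition polar_direction x : 'rV[R]_N := (polar_radius x)^-1 *: x.

(* C^oo: every iterated directional derivative is differentiable everywhere. *)
Definition smooth u : Prop :=
  forall (vs : seq 'rV[R]_N) x, differentiable (foldr (fun v f => 'D_v f) u vs) x.

(* C_c^oo(H^N \ {o}), each function being extended by 0 at o. *)
Definition test_function u : Prop :=
  [/\ smooth u, compact (closure [set x | u x != 0])
    & ~ closure [set x | u x != 0] 0].

Definition sinh (r : R) : R := (expR r - expR (- r)) / 2.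
Definition cosh (r : R) : R := (expR r + expR (- r)) / 2.
Definition coth (r : R) : R := cosh r / sinh r.

Definition radial_derivative u x : R :=
  derive1 (fun r : R => u (r *: polar_direction x)) (polar_radius x).

Definition radial_gradient_sq u x : R := radial_derivative u x ^+ 2.

Definition radial_laplacian u x : R :=
  radial_derivative (radial_derivative u) x
  + (N%:R - 1) * coth (polar_radius x) * radial_derivative u x.

End Calculus.

Section Volume.
Context {R : realType}.
Local Notation mR := (measurableTypeR R).

(* Lebesgue measure on R^N: the N-fold product of that of R. *)
Fixpoint lebesgue_tuple (N : nat) : set (N.-tuple mR) -> \bar R :=
  match N return set (N.-tuple mR) -> \bar R with
  | 0 => \d_[tuple]
  | n.+1 => pushforward (lebesgue_measure \x lebesgue_tuple (N := n))%E
              (fun p : mR * n.-tuple mR => [tuple of p.1 :: p.2])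
  end.

Definition vec (N : nat) (t : N.-tuple mR) : 'rV[R]_N :=
  \row_(i < N) (tnth t i : R).

Definition tuple_direction (N : nat) (t : N.-tuple mR) : N.-tuple mR :=
  [tuple polar_direction (vec t) ord0 i | i < N].

Definition sphere (N : nat) : set (N.-tuple mR) := [set t | polar_radius (vec t) = 1].

(* The surface measure of S^(N-1), as a measure on R^N carried by the sphere:
   the measure of A is N times the Lebesgue measure of the cone
   {s *: w | 0 < s <= 1, w in A}. *)
Definition surface_measure (N : nat) (A : set (N.-tuple mR)) : \bar R :=
  (N%:R%:E * lebesgue_tuple
     [set t | (0 < polar_radius (vec t) <= 1)%R /\ A (tuple_direction t)])%E.

(* dv = (sinh r)^(N-1) dr dsigma *)
Definition hyperbolic_integral (N : nat) (f : 'rV[R]_N -> R) : \bar R :=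
  (\int[lebesgue_measure \x surface_measure (N := N)]_(p in
      `]0%R, +oo[%classic `*` sphere (N := N))
    (f ((p.1 : R) *: vec p.2) * sinh (p.1 : R) ^+ N.-1)%R%:E)%E.

End Volume.

Section VolumeFacts.
Context {R : realType}.
Local Notation mR := (measurableTypeR R).

Lemma measurable_cons_pair n : measurable_fun [set: mR * n.-tuple mR]
   (fun p : mR * n.-tuple mR => [tuple of p.1 :: p.2]).
Proof. by apply: measurable_cons. Qed.

Definition cons_box n (A : set mR) (B : set (n.-tuple mR)) : set (n.+1.-tuple mR) :=
  (fun t : n.+1.-tuple mR => tnth t ord0) @^-1` A `&`
  (fun t : n.+1.-tuple mR => [tuple of behead t]) @^-1` B.

Lemma measurable_cons_box n (A : set mR) (B : set (n.-tuple mR)) :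
  measurable A -> measurable B -> measurable (cons_box A B).
Proof.
move=> mA mB.
apply: measurableI.
  rewrite -[X in measurable X]setTI.
  exact: (@measurable_tnth _ mR n.+1 ord0 measurableT A mA).
rewrite -[X in measurable X]setTI.
exact: (@measurable_behead _ mR n measurableT B mB).
Qed.

Lemma preimage_cons_box n (A : set mR) (B : set (n.-tuple mR)) :
  (fun p : mR * n.-tuple mR => [tuple of p.1 :: p.2]) @^-1` (cons_box A B) = A `*` B.
Proof.
apply/seteqP; split => -[x t] /=; rewrite /cons_box /=.
  move=> [/= Ax Bt]; split => //=.
  by move: Bt; congr B; apply/val_inj.
move=> [/= Ax Bt]; split => //=.
by move: Bt; congr B; apply/val_inj.
Qed.

Section sigma_finite_of.
Context d (T : measurableType d) (mu : {measure set T -> \bar R}).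
Variable sf : sigma_finite setT mu.
Definition sigma_finite_of (_ : sigma_finite setT mu) : set T -> \bar R := mu.
HB.instance Definition _ := Measure.copy (sigma_finite_of sf) mu.
HB.instance Definition _ := Measure_isSigmaFinite.Build _ _ _ (sigma_finite_of sf) sf.
End sigma_finite_of.

Lemma lebesgue_tuple_sig n : { mu : {sigma_finite_measure set (n.-tuple mR) -> \bar R} |
  (mu : set _ -> \bar R) = lebesgue_tuple (N := n)}.
Proof.
elim: n => [|n [mu muE]].
  by exists (\d_([tuple] : 0.-tuple mR)).
pose P := pushforward (@lebesgue_measure R \x mu)%E
  (fun p : mR * n.-tuple mR => [tuple of p.1 :: p.2]).
pose M : {measure set (n.+1.-tuple mR) -> \bar R} :=
  measure_function_pushforward__canonical__measure_function_Measure
    (@lebesgue_measure R \x mu)%E (@measurable_cons_pair n).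
have sf : sigma_finite setT M.
  have /sigma_finiteP[F [TF ndF Foo]] := sigma_finiteT (@lebesgue_measure R).
  have /sigma_finiteP[G [TG ndG Goo]] := sigma_finiteT mu.
  exists (fun k => cons_box (F k) (G k)).
    apply/esym/seteqP; split => // t _.
    have [i _ Fi] : (\bigcup_i F i) (tnth t ord0) by rewrite -TF.
    have [j _ Gj] : (\bigcup_i G i) [tuple of behead t] by rewrite -TG.
    exists (maxn i j) => //; split.
      by have /subsetPset := ndF _ _ (leq_maxl i j); apply.
    by have /subsetPset := ndG _ _ (leq_maxr i j); apply.
  move=> k; have [mF Fk] := Foo k; have [mG Gk] := Goo k.
  split; first exact: measurable_cons_box.
  rewrite /M /= /pushforward preimage_cons_box product_measure1E//.
  by rewrite lte_mul_pinfty// ge0_fin_numE.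
exists (sigma_finite_of sf).
by rewrite /= muE.
Qed.

Lemma lebesgue_tuple0 n : lebesgue_tuple (N:=n) set0 = 0%E :> \bar R.
Proof. have [mu <-] := lebesgue_tuple_sig n; exact: measure0. Qed.
Lemma lebesgue_tuple_ge0 n A : (0 <= lebesgue_tuple (R:=R) (N:=n) A)%E.
Proof. have [mu <-] := lebesgue_tuple_sig n; exact: measure_ge0. Qed.
Lemma lebesgue_tuple_additive n : semi_sigma_additive (lebesgue_tuple (R:=R) (N:=n)).
Proof. have [mu <-] := lebesgue_tuple_sig n; exact: measure_semi_sigma_additive. Qed.
HB.instance Definition _ n := isMeasure.Build _ _ _
  (lebesgue_tuple (R:=R) (N:=n))
  (lebesgue_tuple0 n) (@lebesgue_tuple_ge0 n) (@lebesgue_tuple_additive n).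
Lemma lebesgue_tuple_sigma_finite n : sigma_finite setT (lebesgue_tuple (R:=R) (N:=n)).
Proof. have [mu <-] := lebesgue_tuple_sig n; exact: sigma_finiteT. Qed.
HB.instance Definition _ n := Measure_isSigmaFinite.Build _ _ _
  (lebesgue_tuple (R:=R) (N:=n))
  (lebesgue_tuple_sigma_finite n).
Lemma lebesgue_tuple_box n A B : measurable A -> measurable B ->
 (lebesgue_tuple (R:=R) (N:=n.+1) (cons_box A B) =
  lebesgue_measure A * lebesgue_tuple B)%E.
Proof. by move=> mA mB; rewrite /= /pushforward preimage_cons_box product_measure1E. Qed.

Lemma measurable_vec n i :
  measurable_fun setT (fun t : n.-tuple mR => (vec t ord0 i : mR)).
Proof.
rewrite (_ : (fun _ => _) = (fun t : n.-tuple mR => tnth t i)).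
  exact: measurable_tnth.
by apply/funext => t; rewrite mxE.
Qed.


Lemma measurable_polar_radius n :
  measurable_fun setT (fun t : n.-tuple mR => (polar_radius (vec t) : mR)).
Proof.
apply: (@measurableT_comp _ _ _ _ _ _ (Num.sqrt : mR -> mR) _
  (fun t : n.-tuple mR => (\sum_(i < n) vec t ord0 i ^+ 2 : mR))).
  apply: continuous_measurable_fun; exact: sqrt_continuous.
apply: measurable_sum => i.
apply: measurable_funX; exact: measurable_vec.
Qed.

Lemma polar_radius_ge0 n (x : 'rV[R]_n) : 0 <= polar_radius x.
Proof. exact: sqrtr_ge0. Qed.

Lemma measurable_tuple_direction n : measurable_fun setT (@tuple_direction R n).
Proof.
apply/measurable_fun_tnthP => i.
rewrite (_ : _ \o _ = (fun t : n.-tuple mR =>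
    ((polar_radius (vec t)) `^ (-1)) * vec t ord0 i)); last first.
  by apply/funext => t /=; rewrite tnth_mktuple mxE powR_inv1 ?polar_radius_ge0.
apply: measurable_funM; last exact: measurable_vec.
apply: (@measurableT_comp _ _ _ _ _ _ ((@powR R)^~ (-1) : mR -> mR)).
  exact: measurable_powR.
exact: measurable_polar_radius.
Qed.

Definition punctured_ball n : set (n.-tuple mR) :=
  [set t | 0 < polar_radius (vec t) <= 1].
Arguments punctured_ball : clear implicits.

Lemma measurable_punctured_ball n : measurable (punctured_ball n).
Proof.
rewrite (_ : punctured_ball n = (fun t => polar_radius (vec t)) @^-1` (`]0, 1]%classic)).
  rewrite -[X in measurable X]setTI; apply: measurable_polar_radius => //.
by apply/funext => t; rewrite /= in_itv.
Qed.

Lemma surface_measureE n A : surface_measure (R:=R) (N:=n) A = 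
  (n%:R%:E * pushforward (mrestr (lebesgue_tuple (R:=R) (N:=n))
    (@measurable_punctured_ball n)) (@tuple_direction R n) A)%E.
Proof.
rewrite /surface_measure /pushforward /mrestr; congr (_ * lebesgue_tuple _)%E.
by apply/seteqP; split=> t [].
Qed.

Lemma surface_measure_sig n : {mu : {measure set (n.-tuple mR) -> \bar R} |
  (mu : set _ -> \bar R) = surface_measure (N := n)}.
Proof.
pose nu : {measure set (n.-tuple mR) -> \bar R} :=
  measure_function_pushforward__canonical__measure_function_Measure
    (mrestr (lebesgue_tuple (R:=R) (N:=n)) (@measurable_punctured_ball n))
    (@measurable_tuple_direction n).
exists (mscale (n%:R)%:nng nu); apply/funext => A.
by rewrite surface_measureE.
Qed.

Lemma lebesgue_tuple_cube n : exists B : set (n.-tuple mR), 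
  [/\ measurable B, (lebesgue_tuple B < +oo)%E &
   forall t : n.-tuple mR, (forall i, -1 <= tnth t i <= 1) -> B t].
Proof.
elim: n => [|n [B [mB Boo BP]]].
  by exists setT; split => //=; rewrite ?diracT ?ltry.
exists (cons_box `[-1, 1]%classic B); split.
- exact: measurable_cons_box.
- rewrite lebesgue_tuple_box// lte_mul_pinfty//.
    by rewrite lebesgue_measure_itv/=; case: ifP.
- move=> t tP; split => /=; first by rewrite in_itv/= tP.
  by apply: BP => i; rewrite tnth_behead tP.
Qed.

Lemma surface_measure_lty n : (surface_measure (R:=R) (N:=n) setT < +oo)%E.
Proof.
rewrite surface_measureE lte_mul_pinfty//.
rewrite /pushforward /mrestr preimage_setT setTI.
have [B [mB Boo BP]] := lebesgue_tuple_cube n.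
apply: le_lt_trans Boo; apply: le_measure; rewrite ?inE//.
  exact: measurable_punctured_ball.
move=> t /= /andP[_ t1]; apply: BP => i; rewrite -ler_norml.
apply: le_trans t1; rewrite -sqrtr_sqr ler_wsqrtr// (bigD1 i)//= mxE lerDl.
by apply: sumr_ge0 => j _; exact: sqr_ge0.
Qed.
Let surface_measure0 n : surface_measure (R := R) (N := n) set0 = 0%E.
Proof. by have [mu <-] := surface_measure_sig n; exact: measure0. Qed.

Let surface_measure_ge0 n A : (0 <= surface_measure (R := R) (N := n) A)%E.
Proof. by have [mu <-] := surface_measure_sig n; exact: measure_ge0. Qed.

Let surface_measure_additive n :
  semi_sigma_additive (surface_measure (R := R) (N := n)).
Proof.
by have [mu <-] := surface_measure_sig n; exact: measure_semi_sigma_additive.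
Qed.

HB.instance Definition _ n := isMeasure.Build _ _ _
  (surface_measure (R := R) (N := n)) (surface_measure0 n)
  (@surface_measure_ge0 n) (@surface_measure_additive n).

Let surface_measure_fin n : fin_num_fun (surface_measure (R := R) (N := n)).
Proof. exact/lty_fin_num_fun/surface_measure_lty. Qed.

HB.instance Definition _ n := Measure_isFinite.Build _ _ _
  (surface_measure (R := R) (N := n)) (@surface_measure_fin n).

End VolumeFacts.

Section Constants.
Context {R : realType}.
Variable N : nat.
Local Notation d := (N%:R : R).

(* C_{n,0}^n *)
Definition C_top (n : nat) : R :=
  let p := n./2 in
  if odd n then
    1 / 2 ^+ (4 * p + 2)
    * \prod_(1 <= j < p.+1)
        ((d + 4 * j%:R - 2) ^+ 2 * (d - 4 * j%:R - 2) ^+ 2)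
  else
    ((d - 4) / 2 ^+ (2 * p)) ^+ 2
    * \prod_(1 <= j < p) ((d + 4 * j%:R) ^+ 2 * (d - 4 * j%:R - 4) ^+ 2).

(* C_{n,0}^1 *)
Definition C_one (n : nat) : R :=
  let p := n./2 in
  if odd n then
    d * (d - 1) / 2 ^+ (4 * p + 2)
    * \sum_(1 <= j < p.+1) (d - 1) ^+ (2 * p + 2 * j - 2)
    + (d - 1) ^+ (2 * p) / 2 ^+ (4 * p + 2)
  else
    d * (d - 1) / 2 ^+ (4 * p)
    * \sum_(1 <= j < p.+1) (d - 1) ^+ (4 * p - 2 * j - 2).

(* Xi_{alpha,beta}^0 *)
Definition Xi_zero (alpha : R) (beta : nat) : R :=
  \prod_(0 <= j < beta)
    ((d + alpha + 4 * j%:R) ^+ 2 * (d - alpha - 4 * j%:R - 4) ^+ 2 / 16).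

(* Xi_{alpha,beta}^{2 beta}; it does not depend on alpha. *)
Definition Xi_top (alpha : R) (beta : nat) : R := ((d - 1) / 4) ^+ (2 * beta).

End Constants.

(* Main.v *)
Require Import Defs.
From mathcomp Require Import all_boot all_order all_algebra.
From mathcomp Require Import all_classical all_reals all_analysis.
From mathcomp Require Import measurable_realfun ring lra zify.

Set Implicit Arguments.
Unset Strict Implicit.
Unset Printing Implicit Defensive.

Import Order.TTheory GRing.Theory Num.Theory.
Import numFieldNormedType.Exports.

Local Open Scope classical_set_scope.
Local Open Scope ring_scope.

(** Everything happens along a ray r |-> r w. A smooth profile U compactly
    supported in the open half-line satisfies, for the density (sinh r)^(N-1)
    and with L U = U'' + (N-1) coth r U' and a = (N-1)/2, a weighted Hardy
    inequality ([weighted_hardy]): the integral of - r^(-n) U L U is at least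
    that of r^(-n) U^2 times
      a^2 + a (a-1) / sinh^2 r + (1 - n^2) / (4 r^2).
    It is proved by exhibiting the difference as a square plus the derivative of
    a compactly supported function.

    All the one-step inequalities follow by completing squares. From n = 0 one
    gets Hardy's inequality, the integral of U'^2 being at least that of
    (a^2 + 1/(4 r^2)) U^2 ([poincare_hardy]), and
    (L U)^2 >= (a^4 + N (N-1) / (16 r^2)) U^2 after integration
    ([poincare_rellich]). Combining n = alpha and n = alpha + 2 with
    coth r >= 1/r gives the weighted Rellich inequality ([weighted_rellich]), in
    which (L U)^2 / r^alpha controls U^2 / r^(alpha+4), U^2 / r^(alpha+2) and
    U^2 / r^alpha, the first with the sharp Euclidean constant and the last with
    ((N-1)/4)^2.

    Iterating ([ray_inequality]), the coefficients are sums over the choices made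
    at each step. The two extreme powers of 1/r are reached by the extreme choices
    only, which gives the two prescribed constants ([hardy_coef_top],
    [hardy_coef_bot]), while the middle terms make all the intermediate
    coefficients positive ([hardy_coef_gt0]); the condition N > 2k keeps every
    weight used below the critical one.

    The inequality on rays is then integrated over the sphere. The iterated
    radial derivatives of u are jointly measurable and bounded on an annulus
    containing the support, because each ray derivative is a combination of
    partial derivatives with the direction as coefficients ([ray_smooth_smooth]).
    Tonelli's theorem reduces the integrals to rays ([hyperbolic_integral_le]),
    and finiteness of the integral of the subtracted term
    ([hyperbolic_integral_lty]) allows the subtraction. *)

(** * Derivatives on the half-line and hyperbolic functions *)

Section PointwiseDerivatives.
Context {R : realType}.
Implicit Types (f g : R -> R) (x df dg : R).

(** The rules of differentiation, stated for functions written pointwise with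
    real multiplication, so that they chain syntactically in [ray_derive]. *)
Lemma is_derive_fctD f g x df dg : is_derive x 1 f df -> is_derive x 1 g dg ->
  is_derive x 1 (fun y => f y + g y) (df + dg).
Proof. by move=> dF dG; exact: is_deriveD. Qed.

Lemma is_derive_fctN f x df : is_derive x 1 f df ->
  is_derive x 1 (fun y => - f y) (- df).
Proof. by move=> dF; exact: is_deriveN. Qed.

Lemma is_derive_fctM f g x df dg : is_derive x 1 f df -> is_derive x 1 g dg ->
  is_derive x 1 (fun y => f y * g y) (df * g x + f x * dg).
Proof.
move=> dF dG; apply: (is_derive_eq (is_deriveM dF dG)).
by rewrite /GRing.scale/= addrC [g x * df]mulrC.
Qed.

Lemma is_derive_fctX f n x df : is_derive x 1 f df ->
  is_derive x 1 (fun y => f y ^+ n) (n%:R * f x ^+ n.-1 * df).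
Proof.
move=> dF; by have := is_deriveX n dF; rewrite exprfctE.
Qed.

Lemma is_derive_fct_cst x (c : R) : is_derive x 1 (fun=> c) 0.
Proof. exact: is_derive_cst. Qed.

Lemma is_derive_fct_id x : is_derive x 1 (fun y => y) 1.
Proof. exact: is_derive_id. Qed.

Lemma is_derive_continuous f x df : is_derive x 1 f df -> {for x, continuous f}.
Proof.
by move=> [dF _]; apply/differentiable_continuous; rewrite -derivable1_diffP.
Qed.

Lemma is_derive_inv_id x : x != 0 -> is_derive x 1 (fun y => y^-1) (- x^-1 ^+ 2).
Proof.
move=> x0; apply: (is_derive_eq (is_deriveV x0 (is_derive_fct_id x))).
by rewrite /GRing.scale/= mulr1 exprVn.
Qed.

Lemma is_derive_expRN x : is_derive x 1 (fun y : R => expR (- y)) (- expR (- x)).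
Proof.
have dN := is_derive_fctN (is_derive_fct_id x).
by apply: (is_derive_eq (is_derive1_comp (is_derive_expR _) dN)); rewrite mulrN1.
Qed.

Lemma is_derive_sinh x : is_derive x 1 (@sinh R) (cosh x).
Proof.
have dnum := is_derive_fctD (is_derive_expR x) (is_derive_fctN (is_derive_expRN x)).
apply: (is_derive_eq (is_derive_fctM dnum (is_derive_fct_cst x 2^-1))).
by rewrite mulr0 addr0 opprK.
Qed.

Lemma is_derive_cosh x : is_derive x 1 (@cosh R) (sinh x).
Proof.
apply: (is_derive_eq (is_derive_fctM (is_derive_fctD (is_derive_expR x)
  (is_derive_expRN x)) (is_derive_fct_cst x 2^-1))).
by rewrite mulr0 addr0.
Qed.

Lemma sinh_gt0 x : 0 < x -> 0 < sinh x.
Proof. by move=> x0; rewrite divr_gt0// subr_gt0 ltr_expR gt0_cp. Qed.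

Lemma cosh_gt0 x : 0 < cosh x.
Proof. by rewrite divr_gt0// addr_gt0// expR_gt0. Qed.

Lemma cosh2_sinh2 x : cosh x ^+ 2 - sinh x ^+ 2 = 1.
Proof.
have := expRxMexpNx_1 x; rewrite /cosh /sinh.
move: (expR x) (expR (- x)) => p q pq.
have -> : ((p + q) / 2) ^+ 2 - ((p - q) / 2) ^+ 2 = p * q by field.
exact: pq.
Qed.

Lemma is_derive_coth x : 0 < x -> is_derive x 1 (@coth R) (1 - coth x ^+ 2).
Proof.
move=> x0; have s0 : sinh x != 0 by rewrite gt_eqF// sinh_gt0.
apply: (is_derive_eq (is_derive_fctM (is_derive_cosh x) (is_deriveV s0 (is_derive_sinh x)))).
rewrite /GRing.scale/= /coth.
by field.
Qed.

(** Equivalently tanh r <= r: the function r cosh r - sinh r vanishes at 0 and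
    has derivative r sinh r. *)
Lemma sinh_le_mul_cosh x : 0 <= x -> sinh x <= x * cosh x.
Proof.
move=> x0; rewrite -subr_ge0.
pose f (y : R) := y * cosh y - sinh y.
have df (y : R) : is_derive y 1 f (y * sinh y).
  apply: (is_derive_eq (is_derive_fctD (is_derive_fctM (is_derive_fct_id y) (is_derive_cosh y))
    (is_derive_fctN (is_derive_sinh y)))).
  by rewrite mul1r addrAC subrr add0r.
have f0 : f 0 = 0 by rewrite /f mul0r /sinh oppr0 subrr mul0r subr0.
have cf : {within `[0, x], continuous f}.
  by apply: derivable_within_continuous => y _; case: (df y).
rewrite -[leLHS]f0.
have df' y : y \in `]0, x[%R -> derivable f y 1 by case: (df y).
apply: (@ger0_derive1_ndecr _ f 0 x df' _ cf) => // y.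
rewrite in_itv/= => /andP[y0 _].
by rewrite derive1E (@derive_val _ _ _ _ _ _ _ (df y)) mulr_ge0// ltW// sinh_gt0.
Qed.

(** This comparison is the only link between the hyperbolic potential and the
    Euclidean one, coth^2 r >= 1/r^2. *)
Lemma coth_ge_inv x : 0 < x -> x^-1 <= coth x.
Proof.
move=> x0; rewrite /coth ler_pdivlMr ?sinh_gt0// mulrC ler_pdivrMr// mulrC.
exact/sinh_le_mul_cosh/ltW.
Qed.

Lemma coth2_ge1 x : 0 < x -> 1 <= coth x ^+ 2.
Proof.
move=> x0; rewrite /coth expr_div_n ler_pdivlMr ?exprn_gt0 ?sinh_gt0// mul1r.
by rewrite -subr_ge0 cosh2_sinh2.
Qed.

End PointwiseDerivatives.

(** Differentiates a pointwise expression at a point known to be positive; the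
    derivative is an existential variable that the rules fill in. Instance
    resolution is bypassed so that these rules alone determine its form. *)
Ltac ray_derive :=
  lazymatch goal with
  | |- is_derive _ _ (fun _ => ?c) _ => exact: is_derive_fct_cst
  | |- is_derive _ _ (fun y => y) _ => exact: is_derive_fct_id
  | |- is_derive _ _ (fun y => @?f y + @?g y) _ =>
      notypeclasses refine (@is_derive_fctD _ f g _ _ _ _ _); [ray_derive | ray_derive]
  | |- is_derive _ _ (fun y => - @?f y) _ =>
      notypeclasses refine (@is_derive_fctN _ f _ _ _); ray_derive
  | |- is_derive _ _ (fun y => @?f y * @?g y) _ =>
      notypeclasses refine (@is_derive_fctM _ f g _ _ _ _ _); [ray_derive | ray_derive]
  | |- is_derive _ _ (fun y => @?f y ^+ ?n) _ =>
      notypeclasses refine (@is_derive_fctX _ f n _ _ _); ray_derive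
  | |- is_derive _ _ (fun y => y^-1) _ => apply: is_derive_inv_id; by rewrite gt_eqF
  | |- is_derive _ _ (fun y => sinh y) _ => exact: is_derive_sinh
  | |- is_derive _ _ (fun y => coth y) _ => exact: is_derive_coth
  | _ => eassumption
  end.

(** * Inequalities modulo exact derivatives *)

Section NonnegUpToExact.
Context {R : realType} (N : nat) (A B : R).
Implicit Types F : R -> R.

(** F dominates, for the density (sinh r)^(N-1), the derivative of a function
    that vanishes off [A, B]; integrating, the integral of F is nonnegative.
    Integration by parts thus becomes pointwise algebra, and such F form a
    convex cone in which all the radial inequalities can be chained. *)
Definition nonneg_up_to_exact F := exists G g : R -> R,
  [/\ forall r : R, 0 < r -> is_derive r 1 G (g r),
      forall r : R, 0 < r -> {for r, continuous g},
      forall r : R, 0 < r -> ~~ (A <= r <= B) -> G r = 0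
    & forall r : R, 0 < r -> g r <= F r * sinh r ^+ N.-1].

Lemma nonneg_up_to_exact_ge F1 F2 : (forall r : R, 0 < r -> F1 r <= F2 r) ->
  nonneg_up_to_exact F1 -> nonneg_up_to_exact F2.
Proof.
move=> F12 [G [g [dG cg G0 gF]]]; exists G, g; split => // r r0.
apply: le_trans (gF r r0) _; rewrite ler_wpM2r ?F12//.
by rewrite exprn_ge0// ltW// sinh_gt0.
Qed.

Lemma nonneg_up_to_exact0 : nonneg_up_to_exact (fun=> 0).
Proof.
exists (fun=> 0), (fun=> 0); split => // [r _|r _|r _].
- exact: is_derive_fct_cst.
- exact: cst_continuous.
- by rewrite mul0r.
Qed.

Lemma nonneg_up_to_exactD F1 F2 : nonneg_up_to_exact F1 ->
  nonneg_up_to_exact F2 -> nonneg_up_to_exact (fun r => F1 r + F2 r).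
Proof.
move=> [G [g [dG cg G0 gF]]] [H [h [dH ch H0 hF]]].
exists (fun r => G r + H r), (fun r => g r + h r); split.
- by move=> r r0; apply: is_derive_fctD; [exact: dG|exact: dH].
- by move=> r r0; apply: cvgD; [exact: cg|exact: ch].
- by move=> r r0 rAB; rewrite G0// H0// addr0.
- by move=> r r0; rewrite mulrDl lerD ?gF ?hF.
Qed.

Lemma nonneg_up_to_exactZ c F : 0 <= c -> nonneg_up_to_exact F ->
  nonneg_up_to_exact (fun r => c * F r).
Proof.
move=> c0 [G [g [dG cg G0 gF]]].
exists (fun r => c * G r), (fun r => c * g r); split.
- move=> r r0; apply: (is_derive_eq (is_derive_fctM (is_derive_fct_cst r c) (dG r r0))).
  by rewrite mul0r add0r.
- by move=> r r0; apply: cvgM; [exact: cvg_cst|exact: cg].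
- by move=> r r0 rAB; rewrite G0// mulr0.
- by move=> r r0; rewrite -mulrA ler_wpM2l ?gF.
Qed.

Lemma nonneg_up_to_exact_sum (I : eqType) (s : seq I) (F : I -> R -> R) :
  {in s, forall i, nonneg_up_to_exact (F i)} ->
  nonneg_up_to_exact (fun r => \sum_(i <- s) F i r).
Proof.
elim: s => [_|i s IH FP].
  by apply: nonneg_up_to_exact_ge nonneg_up_to_exact0 => r _; rewrite big_nil.
have Fs : {in s, forall j, nonneg_up_to_exact (F j)}.
  by move=> j js; apply: FP; rewrite in_cons js orbT.
apply: nonneg_up_to_exact_ge (nonneg_up_to_exactD (FP i (mem_head _ _)) (IH Fs)) => r _.
by rewrite big_cons.
Qed.

End NonnegUpToExact.

(** * One-step Hardy and Rellich inequalities on a ray *)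

Section RayInequalities.
Context {R : realType} (N : nat) (N2 : (2 < N)%N) (A B : R).
Local Notation nonneg_up_to_exact := (@nonneg_up_to_exact R N A B).
Local Notation d := (N%:R : R).

(** The radial Laplacian of a profile with first and second derivatives U1 and
    U2. *)
Definition profile_laplacian (U1 U2 : R -> R) (r : R) : R :=
  U2 r + (d - 1) * coth r * U1 r.

Variables (U U1 U2 : R -> R).
Hypothesis dU : forall r : R, 0 < r -> is_derive r 1 U (U1 r).
Hypothesis dU1 : forall r : R, 0 < r -> is_derive r 1 U1 (U2 r).
Hypothesis dU2 : forall r : R, 0 < r -> derivable U2 r 1.
Hypothesis U_supp : forall r : R, 0 < r -> ~~ (A <= r <= B) -> U r = 0.
Local Notation L := (profile_laplacian U1 U2).
Local Notation a := ((d - 1) / 2).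

Lemma natr_predE : N.-1%:R = d - 1 :> R.
Proof. by rewrite -[in RHS](ltn_predK N2) -natr1 addrK. Qed.

Lemma derive_sinh_expE (r : R) : 0 < r ->
  N.-1%:R * sinh r ^+ N.-1.-1 * cosh r = (d - 1) * coth r * sinh r ^+ N.-1.
Proof.
move=> r0; rewrite natr_predE /coth; have s0 : sinh r != 0 by rewrite gt_eqF// sinh_gt0.
case: N N2 => [|[|n]]// _ /=; rewrite exprS.
by move: (cosh r) (sinh r) s0 (sinh r ^+ n) => c s s0 t; field.
Qed.

(** With a = (N-1)/2, conjugating by (sinh r)^a turns the radial Laplacian into
    f'' - W f with W = a^2 + a (a-1) / sinh^2 r, and 1 / sinh^2 = coth^2 - 1. *)
Lemma hardy_potential_ge0 : 0 <= a * (a - 1).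
Proof.
have d3 : 3 <= d by rewrite ler_nat.
by nra.
Qed.

(** Green's formula: the function is exactly the derivative of
    U U' (sinh r)^(N-1), divided by the density. *)
Lemma dirichlet_identity :
  nonneg_up_to_exact (fun r => U1 r ^+ 2 + U r * L r).
Proof.
exists (fun r => U r * U1 r * sinh r ^+ N.-1),
  (fun r => (U1 r ^+ 2 + U r * (U2 r + (d - 1) * coth r * U1 r)) * sinh r ^+ N.-1).
split => //.
- move=> r r0; have H := dU r0; have H1 := dU1 r0.
  notypeclasses refine (is_derive_eq _ _); first ray_derive.
  by rewrite derive_sinh_expE//; ring.
- move=> r r0; have H := dU r0; have H1 := dU1 r0; have H2 := derivableP (dU2 r0).
  notypeclasses refine (is_derive_continuous (df := _) _); ray_derive.
- by move=> r r0 /U_supp->; rewrite // !mul0r.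
Qed.

(** Hardy's inequality with weight r^(-n), both for r -> 0 and for r -> oo with
    the best constants. The virtual ground state is
    phi = r^((1+n)/2) (sinh r)^(-a): up to an exact derivative the left-hand
    side is r^(-n) (U' - (phi'/phi) U)^2, where
    phi'/phi = (1+n)/(2r) - a coth r. *)
Lemma weighted_hardy (n : nat) :
  nonneg_up_to_exact (fun r => - r^-1 ^+ n * U r * L r
    - r^-1 ^+ n * U r ^+ 2 * (a ^+ 2 + a * (a - 1) * (coth r ^+ 2 - 1)
                              + (1 - n%:R ^+ 2) / 4 * r^-1 ^+ 2)).
Proof.
exists (fun r => r^-1 ^+ n * (- (U r * U1 r) + (2^-1 * r^-1 - a * coth r) * U r ^+ 2)
                 * sinh r ^+ N.-1),
  (fun r => (- r^-1 ^+ n * U r * (U2 r + (d - 1) * coth r * U1 r)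
    - r^-1 ^+ n * U r ^+ 2 * (a ^+ 2 + a * (a - 1) * (coth r ^+ 2 - 1)
                              + (1 - n%:R ^+ 2) / 4 * r^-1 ^+ 2)
    - r^-1 ^+ n * (U1 r - ((1 + n%:R) / 2 * r^-1 - a * coth r) * U r) ^+ 2) * sinh r ^+ N.-1).
split => //.
- move=> r r0; have H := dU r0; have H1 := dU1 r0.
  notypeclasses refine (is_derive_eq _ _); first ray_derive.
  have nE : n%:R * r^-1 ^+ n.-1 * (- r^-1 ^+ 2) = - n%:R * r^-1 ^+ n * r^-1.
    case: n => [|n]; first by rewrite !mul0r oppr0 !mul0r.
    by rewrite [in RHS]exprS /=; ring.
  by rewrite nE derive_sinh_expE//; field; rewrite gt_eqF.
- move=> r r0; have H := dU r0; have H1 := dU1 r0; have H2 := derivableP (dU2 r0).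
  notypeclasses refine (is_derive_continuous (df := _) _); ray_derive.
- by move=> r r0 /U_supp->; rewrite // !mul0r expr0n mulr0 oppr0 addr0 mulr0 mul0r.
- move=> r r0; rewrite ler_wpM2r//; first by rewrite exprn_ge0// ltW// sinh_gt0.
  by rewrite lerBlDr lerDl mulr_ge0 ?sqr_ge0// exprn_ge0// invr_ge0 ltW.
Qed.

(** The case n = 0 of the weighted inequality, after replacing - U L by U'^2. *)
Lemma poincare_hardy : nonneg_up_to_exact (fun r =>
  U1 r ^+ 2 - (a ^+ 2 + 4^-1 * r^-1 ^+ 2) * U r ^+ 2).
Proof.
apply: nonneg_up_to_exact_ge (nonneg_up_to_exactD dirichlet_identity (weighted_hardy 0)).
move=> r r0; have b0 := hardy_potential_ge0; have C1 := coth2_ge1 r0.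
rewrite -subr_ge0 [leRHS](_ : _ = a * (a - 1) * ((coth r ^+ 2 - 1) * U r ^+ 2)).
  by rewrite mulr_ge0// mulr_ge0 ?sqr_ge0// subr_ge0.
by rewrite !expr0; field; rewrite gt_eqF.
Qed.

(** Complete the square with L + a^2 U, and apply Hardy's inequality to the
    cross term - 2 a^2 U L: of the surplus a^2 / (2 r^2) only
    N (N-1) / (16 r^2) is kept. *)
Lemma poincare_rellich : nonneg_up_to_exact (fun r =>
  L r ^+ 2 - (a ^+ 4 + d * (d - 1) / 16 * r^-1 ^+ 2) * U r ^+ 2).
Proof.
have a2 : 0 <= 2 * a ^+ 2 by rewrite mulr_ge0// sqr_ge0.
apply: nonneg_up_to_exact_ge (nonneg_up_to_exactZ a2 (weighted_hardy 0)).
move=> r r0; have b0 := hardy_potential_ge0; have C1 := coth2_ge1 r0.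
rewrite -subr_ge0 [leRHS](_ : _ = (L r + a ^+ 2 * U r) ^+ 2
    + 2 * a ^+ 2 * (a * (a - 1) * ((coth r ^+ 2 - 1) * U r ^+ 2))
    + (d - 1) * (d - 2) / 16 * (r^-1 ^+ 2 * U r ^+ 2)).
  have d2 : 2 <= d by rewrite ler_nat ltnW.
  have d1 : 1 <= d by lra.
  rewrite !addr_ge0 ?sqr_ge0//.
    by rewrite mulr_ge0// mulr_ge0// mulr_ge0 ?sqr_ge0// subr_ge0.
  by apply: mulr_ge0; [rewrite divr_ge0// mulr_ge0 ?subr_ge0|rewrite mulr_ge0 ?sqr_ge0].
by rewrite !expr0; field; rewrite gt_eqF.
Qed.

(** For the weight r^(-alpha), alpha = 2i, this is the Euclidean Rellich constant
    (N + alpha) (N - alpha - 4) / 4. *)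
Definition rellich_const (i : nat) : R :=
  (d + (2 * i)%:R) * (d - (2 * i)%:R - 4) / 4.

Definition rellich_mid_const (i : nat) : R :=
  2 * a * rellich_const i + 2 * a * (2 * i + 1)%:R.

Lemma rellich_const_ge0 (i : nat) : (2 * i + 4 <= N)%N -> 0 <= rellich_const i.
Proof.
move=> iN; have i4 : (2 * i)%:R + 4 <= d by rewrite -natrD ler_nat.
by apply: divr_ge0 => //; apply: mulr_ge0; [exact: addr_ge0|lra].
Qed.

(** Complete the square with L + (Q/r^2 + a) U, where Q is the Euclidean Rellich
    constant, and apply the weighted Hardy inequality to the cross term with the
    two weights r^(-alpha-2) and r^(-alpha). The potential is
    W = a + a (a-1) coth^2 r >= a + a (a-1) / r^2; its Euclidean part reproduces
    Q^2 sharply, and its constant part a yields a positive middle term and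
    a^2 r^(-alpha), of which a quarter is kept. *)
Lemma weighted_rellich (i : nat) : (2 * i + 4 <= N)%N -> nonneg_up_to_exact (fun r =>
  r^-1 ^+ (2 * i) * L r ^+ 2
  - (rellich_const i ^+ 2 * r^-1 ^+ (2 * (i + 2))
     + rellich_mid_const i * r^-1 ^+ (2 * (i + 1))
     + (a / 2) ^+ 2 * r^-1 ^+ (2 * i)) * U r ^+ 2).
Proof.
move=> iN.
have d2 : 2 <= d by rewrite ler_nat ltnW.
have d1 : 1 <= d by lra.
have a0 : 0 <= a by rewrite divr_ge0// subr_ge0.
have Q0 := rellich_const_ge0 iN.
have Q2 : 0 <= 2 * rellich_const i by rewrite mulr_ge0.
have a2 : 0 <= 2 * a by rewrite mulr_ge0.
apply: nonneg_up_to_exact_ge (nonneg_up_to_exactD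
  (nonneg_up_to_exactZ Q2 (weighted_hardy (2 * i + 2)))
  (nonneg_up_to_exactZ a2 (weighted_hardy (2 * i)))).
move=> r r0; have b0 := hardy_potential_ge0.
have X0 : 0 < r^-1 by rewrite invr_gt0.
have C1 : 0 <= coth r ^+ 2 - r^-1 ^+ 2.
  by rewrite subr_ge0 lerXn2r ?nnegrE ?coth_ge_inv// ?ltW// (lt_le_trans X0)// coth_ge_inv.
rewrite -subr_ge0 [leRHS](_ : _ = r^-1 ^+ (2 * i) *
    ((L r + (rellich_const i * r^-1 ^+ 2 + a) * U r) ^+ 2
    + 2 * (rellich_const i * r^-1 ^+ 2 + a) *
       (a * (a - 1) * ((coth r ^+ 2 - r^-1 ^+ 2) * U r ^+ 2))
    + 3 / 4 * a ^+ 2 * U r ^+ 2)).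
  apply: mulr_ge0; first by rewrite exprn_ge0// ltW.
  have l0 : 0 <= rellich_const i * r^-1 ^+ 2 + a.
    by apply: addr_ge0 => //; apply: mulr_ge0 => //; exact: sqr_ge0.
  apply: addr_ge0; last by rewrite mulr_ge0 ?sqr_ge0// mulr_ge0 ?sqr_ge0// divr_ge0.
  rewrite addr_ge0 ?sqr_ge0// mulr_ge0 //; first by rewrite mulr_ge0.
  by rewrite mulr_ge0// mulr_ge0// sqr_ge0.
rewrite /rellich_mid_const /rellich_const !mulnDr.
by move: (2 * i)%N => n; rewrite !natrD !exprD; field; rewrite gt_eqF.
Qed.

End RayInequalities.

(** * The constants produced by iteration *)

Section Coefficients.
Context {R : realType} (N : nat) (N2 : (2 < N)%N).
Local Notation d := (N%:R : R).
Local Notation a := ((d - 1) / 2).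

(** The coefficient of U^2 / r^(2j) obtained from (L^b U)^2 / r^(2i) by applying
    the weighted Rellich inequality b times; each step moves the exponent i to
    i + 2, i + 1 and i. *)
Fixpoint rellich_coef (b i j : nat) : R :=
  if b is b'.+1 then
    rellich_const N i ^+ 2 * rellich_coef b' (i + 2) j
    + rellich_mid_const N i * rellich_coef b' (i + 1) j
    + (a / 2) ^+ 2 * rellich_coef b' i j
  else (i == j)%:R.

Lemma dim_shift_gt0 : 0 < a.
Proof.
have d2 : 2 <= d by rewrite ler_nat ltnW.
by rewrite divr_gt0// subr_gt0; lra.
Qed.

Lemma rellich_const_gt0 i : (2 * i + 4 < N)%N -> 0 < rellich_const N i :> R.
Proof.
move=> iN; have i4 : (2 * i)%:R + 4 < d by rewrite -natrD ltr_nat.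
apply: divr_gt0 => //; apply: mulr_gt0; last by lra.
by rewrite -natrD ltr0n; lia.
Qed.

Lemma rellich_mid_const_gt0 i : (2 * i + 4 < N)%N -> 0 < rellich_mid_const N i :> R.
Proof.
move=> iN; have a0 := dim_shift_gt0; have Q0 := rellich_const_gt0 iN.
have M0 : 0 < (2 * i + 1)%:R :> R by rewrite ltr0n addn1.
by apply: addr_gt0; apply: mulr_gt0 => //; apply: mulr_gt0.
Qed.

Lemma rellich_mid_const_ge0 i : (2 * i + 4 <= N)%N -> 0 <= rellich_mid_const N i :> R.
Proof.
move=> iN; have a0 := ltW dim_shift_gt0; have Q0 := @rellich_const_ge0 R N i iN.
by apply: addr_ge0; apply: mulr_ge0 => //; apply: mulr_ge0.
Qed.

(** Every exponent between i and i + 2b is reached by some sequence of moves, and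
    2i + 4b < N keeps each one-step constant positive. *)
Lemma rellich_coef_gt0 b i j : (2 * i + 4 * b < N)%N -> (i <= j <= i + 2 * b)%N ->
  0 < rellich_coef b i j.
Proof.
have ge0 : forall b i j, (2 * i + 4 * b < N)%N -> 0 <= rellich_coef b i j.
  elim=> [|c IH] i' j' iN /=; first by rewrite ler0n.
  have iN4 : (2 * i' + 4 < N)%N by lia.
  have Q0 := rellich_const_gt0 iN4; have M0 := rellich_mid_const_gt0 iN4.
  rewrite !addr_ge0// mulr_ge0 ?sqr_ge0// ?(ltW M0)// IH//; lia.
elim: b i j => [|b IH] i j iN ij /=.
  by rewrite (_ : i = j) ?eqxx//; lia.
have iN4 : (2 * i + 4 < N)%N by lia.
have Q0 := rellich_const_gt0 iN4; have M0 := rellich_mid_const_gt0 iN4.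
have a0 := dim_shift_gt0.
have t1 : 0 <= rellich_const N i ^+ 2 * rellich_coef b (i + 2) j.
  by rewrite mulr_ge0 ?sqr_ge0// ge0//; lia.
have t2 : 0 <= rellich_mid_const N i * rellich_coef b (i + 1) j.
  by rewrite mulr_ge0 ?(ltW M0)// ge0//; lia.
have t3 : 0 <= (a / 2) ^+ 2 * rellich_coef b i j.
  by rewrite mulr_ge0 ?sqr_ge0// ge0//; lia.
have [j2|j2] := leqP (i + 2) j.
  apply: ltr_wpDr => //; apply: ltr_wpDr => //.
  by apply: mulr_gt0; [exact: exprn_gt0|apply: IH; lia].
have [j1|j1] := leqP (i + 1) j.
  apply: ltr_wpDr => //; apply: ltr_wpDl => //.
  by apply: mulr_gt0 => //; apply: IH; lia.
apply: ltr_wpDl; first exact: addr_ge0.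
by apply: mulr_gt0; [exact/exprn_gt0/divr_gt0|apply: IH; lia].
Qed.

Lemma rellich_coef_eq0 b i j : (j < i)%N || (i + 2 * b < j)%N -> rellich_coef b i j = 0.
Proof.
elim: b i => [|b IH] i ij /=; first by case: eqP => // ?; lia.
by rewrite !IH ?mulr0 ?addr0//; lia.
Qed.

Lemma rellich_coef_ge0 b i j : (2 * i + 4 * b < N)%N -> 0 <= rellich_coef b i j.
Proof.
move=> iN; have [ij|ij] := boolP (i <= j <= i + 2 * b)%N.
  exact/ltW/rellich_coef_gt0.
by rewrite rellich_coef_eq0//; move: ij; rewrite negb_and -!ltnNge.
Qed.

(** The exponent stays put only if each step uses its last term. *)
Lemma rellich_coef_bot b i : rellich_coef b i i = ((d - 1) / 4) ^+ (2 * b).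
Proof.
elim: b => [|b IH] /=; first by rewrite eqxx.
rewrite (@rellich_coef_eq0 b (i + 2)) ?(@rellich_coef_eq0 b (i + 1)); [|lia..].
rewrite !mulr0 !add0r.
by rewrite IH mulnS exprD; congr (_ ^+ 2 * _); field.
Qed.

(** The maximal exponent is reached only if each step uses its first term, with
    the weights alpha, alpha + 4, alpha + 8, and so on. *)
Lemma rellich_coef_top b i :
  rellich_coef b i (i + 2 * b) = Xi_zero N (2 * i)%:R b.
Proof.
elim: b i => [|b IH] i /=.
  by rewrite muln0 addn0 eqxx /Xi_zero big_nil.
rewrite [X in _ * X + _](_ : _ = Xi_zero N (2 * (i + 2))%:R b); last first.
  by rewrite -IH; congr rellich_coef; lia.
rewrite (@rellich_coef_eq0 b (i + 1)) ?(@rellich_coef_eq0 b i); [|lia..].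
rewrite !mulr0 !addr0 /Xi_zero big_nat_recl//.
congr (_ * _).
  by rewrite /rellich_const mulr0 addr0 subr0; field.
apply: eq_bigr => j _; have j1 : j.+1%:R = j%:R + 1 :> R by rewrite natr1.
rewrite j1 !natrM natrD; by congr (_ ^+ 2 * _ ^+ 2 / _); ring.
Qed.

(** The coefficient of U^2 / r^2 in the lower bound for (L^p U)^2: either the
    first step yields a^4 and the remaining steps are iterated, or it
    yields 1/r^2, which the p' remaining Rellich steps preserve. *)
Fixpoint poincare_rellich_coef (p : nat) : R :=
  if p is p'.+1 then
    a ^+ 4 * poincare_rellich_coef p' + d * (d - 1) / 16 * ((d - 1) / 4) ^+ (2 * p')
  else 0.

Lemma poincare_rellich_coefE p : poincare_rellich_coef p =
  d * (d - 1) / 2 ^+ (4 * p) * \sum_(1 <= j < p.+1) (d - 1) ^+ (4 * p - 2 * j - 2).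
Proof.
elim: p => [|p IH] /=; first by rewrite big_nil mulr0.
rewrite IH [in RHS]big_nat_recr//= mulrDr.
have -> : (4 * p.+1 - 2 * p.+1 - 2 = 2 * p)%N by lia.
have -> : \sum_(1 <= j < p.+1) (d - 1) ^+ (4 * p.+1 - 2 * j - 2) =
   (d - 1) ^+ 4 * \sum_(1 <= j < p.+1) (d - 1) ^+ (4 * p - 2 * j - 2) :> R.
  rewrite big_distrr/= big_nat [RHS]big_nat; apply: eq_bigr => j jp.
  by rewrite -exprD; congr (_ ^+ _); lia.
rewrite mulnS exprD [in X in _ + X = _]expr_div_n.
have -> : (4 : R) ^+ (2 * p) = 2 ^+ (4 * p).
  by rewrite (_ : 4 * p = 2 * (2 * p))%N ?exprM//; [congr (_ ^+ _); ring|lia].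
have e0 : (2 : R) ^+ (4 * p) != 0 by rewrite expf_eq0/= pnatr_eq0 andbF.
move: (2 ^+ (4 * p)) e0 => e e0; set S := \sum_(_ <= _ < _) _.
by field.
Qed.

Lemma C_oneE p : C_one N (2 * p + 1) =
  a ^+ 2 * poincare_rellich_coef p + 4^-1 * ((d - 1) / 4) ^+ (2 * p).
Proof.
rewrite /C_one oddD oddM/= addn1/= mul2n uphalf_double -mul2n poincare_rellich_coefE.
have -> : \sum_(1 <= j < p.+1) (d - 1) ^+ (2 * p + 2 * j - 2) =
   (d - 1) ^+ 2 * \sum_(1 <= j < p.+1) (d - 1) ^+ (4 * p - 2 * j - 2) :> R.
  rewrite big_distrr/= big_nat_rev/= big_nat [RHS]big_nat; apply: eq_bigr => j jp.
  by rewrite -exprD; congr (_ ^+ _); lia.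
rewrite exprD [((d - 1) / 4) ^+ _]expr_div_n.
have -> : (4 : R) ^+ (2 * p) = 2 ^+ (4 * p).
  by rewrite (_ : 4 * p = 2 * (2 * p))%N ?exprM//; [congr (_ ^+ _); ring|lia].
have e0 : (2 : R) ^+ (4 * p) != 0 by rewrite expf_eq0/= pnatr_eq0 andbF.
move: (2 ^+ (4 * p)) e0 => e e0; set S := \sum_(_ <= _ < _) _.
by field.
Qed.

Lemma C_topE p : C_top N (2 * p + 1) = 4^-1 * Xi_zero N 2 p :> R.
Proof.
rewrite /C_top oddD oddM/= addn1/= mul2n uphalf_double /Xi_zero.
rewrite [in RHS]big_split/= prodr_const_nat subn0 big_add1/=.
rewrite (_ : (16^-1) ^+ p = (2 ^+ (4 * p))^-1); last first.
  have -> : 16 = 2 ^+ 4 :> R by ring.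
  by rewrite exprM exprVn.
rewrite exprD; set P := (X in _ * X = _); set Q := (X in _ * (X / _)).
have -> : P = Q.
  apply: eq_bigr => j _; have j1 : j.+1%:R = j%:R + 1 :> R by rewrite natr1.
  by rewrite j1; congr (_ ^+ 2 * _ ^+ 2); ring.
have e0 : (2 : R) ^+ (4 * p) != 0 by rewrite expf_eq0/= pnatr_eq0 andbF.
by move: (2 ^+ (4 * p)) e0 => e e0; field.
Qed.

End Coefficients.

(** * Iterated inequalities on a ray *)

Section IteratedLaplacian.
Context {R : realType} (N : nat) (N2 : (2 < N)%N) (A B : R).
Local Notation nonneg_up_to_exact := (@nonneg_up_to_exact R N A B).
Local Notation d := (N%:R : R).
Local Notation a := ((d - 1) / 2).

Variables V V1 V2 : nat -> R -> R.
Hypothesis dV : forall j (r : R), 0 < r -> is_derive r 1 (V j) (V1 j r).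
Hypothesis dV1 : forall j (r : R), 0 < r -> is_derive r 1 (V1 j) (V2 j r).
Hypothesis dV2 : forall j (r : R), 0 < r -> derivable (V2 j) r 1.
Hypothesis V_supp : forall j (r : R), 0 < r -> ~~ (A <= r <= B) -> V j r = 0.
Hypothesis VS : forall j (r : R), 0 < r ->
  V j.+1 r = profile_laplacian N (V1 j) (V2 j) r.

Lemma iterated_rellich b i q K : (2 * i + 4 * b <= N)%N -> (i + 2 * b < K)%N ->
  nonneg_up_to_exact (fun r => r^-1 ^+ (2 * i) * V (q + b) r ^+ 2
    - \sum_(0 <= j < K) rellich_coef N b i j * r^-1 ^+ (2 * j) * V q r ^+ 2).
Proof.
elim: b i => [|b IH] i iN iK.
  apply: nonneg_up_to_exact_ge (nonneg_up_to_exact0 _ _ _) => r r0.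
  rewrite addn0 (bigD1_seq i) ?iota_uniq ?mem_index_iota//=; [|lia..].
  rewrite eqxx mul1r big1 ?addr0 ?subrr// => j /negPf ji.
  by rewrite eq_sym ji !mul0r.
have iN4 : (2 * i + 4 <= N)%N by lia.
have R0 := weighted_rellich N2 (@dV (q + b)) (@dV1 (q + b)) (@dV2 (q + b)) (@V_supp (q + b)) iN4.
have c0 := sqr_ge0 (@rellich_const R N i).
have c1 : 0 <= @rellich_mid_const R N i by apply: rellich_mid_const_ge0.
have c2 := sqr_ge0 (a / 2).
have I0 := nonneg_up_to_exactZ c0 (IH (i + 2)%N ltac:(lia) ltac:(lia)).
have I1 := nonneg_up_to_exactZ c1 (IH (i + 1)%N ltac:(lia) ltac:(lia)).
have I2 := nonneg_up_to_exactZ c2 (IH i ltac:(lia) ltac:(lia)).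
apply: nonneg_up_to_exact_ge (nonneg_up_to_exactD R0
  (nonneg_up_to_exactD I0 (nonneg_up_to_exactD I1 I2))) => r r0.
rewrite [(q + b.+1)%N]addnS VS// le_eqVlt; apply/orP; left; apply/eqP.
pose S i' := \sum_(0 <= j < K) rellich_coef N b i' j * r^-1 ^+ (2 * j) * V q r ^+ 2.
have -> : \sum_(0 <= j < K) rellich_coef N b.+1 i j * r^-1 ^+ (2 * j) * V q r ^+ 2
  = rellich_const N i ^+ 2 * S (i + 2)%N + rellich_mid_const N i * S (i + 1)%N
    + (a / 2) ^+ 2 * S i.
  rewrite !big_distrr -!big_split/=; apply: eq_bigr => j _.
  by move: (_ ^+ (2 * j)) => x /=; ring.
by rewrite /S; ring.
Qed.

(** Only the constant and the 1/r^2 terms are recorded: in the final inequality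
    all the other powers come from the Rellich chain. *)
Lemma iterated_poincare_rellich p q : (2 + 4 * p < N)%N ->
  nonneg_up_to_exact (fun r => V (q + p) r ^+ 2
    - (a ^+ (4 * p) + poincare_rellich_coef N p * r^-1 ^+ 2) * V q r ^+ 2).
Proof.
elim: p => [|p IH] pN.
  apply: nonneg_up_to_exact_ge (nonneg_up_to_exact0 _ _ _) => r r0.
  by rewrite addn0 muln0 expr0 mul0r addr0 mul1r subrr.
have S0 := poincare_rellich N2 (@dV (q + p)) (@dV1 (q + p)) (@dV2 (q + p)) (@V_supp (q + p)).
have c0 : 0 <= a ^+ 4 by rewrite exprn_even_ge0.
have c1 : 0 <= d * (d - 1) / 16.
  by rewrite divr_ge0// mulr_ge0// subr_ge0 ler1n; lia.
have I0 := nonneg_up_to_exactZ c0 (IH ltac:(lia)).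
have I1 := nonneg_up_to_exactZ c1 (@iterated_rellich p 1 q (2 + 2 * p) ltac:(lia) ltac:(lia)).
apply: nonneg_up_to_exact_ge (nonneg_up_to_exactD S0 (nonneg_up_to_exactD I0 I1)) => r r0.
rewrite [(q + p.+1)%N]addnS VS//.
have le1 : ((d - 1) / 4) ^+ (2 * p) * r^-1 ^+ 2 * V q r ^+ 2 <=
    \sum_(0 <= j < 2 + 2 * p) rellich_coef N p 1 j * r^-1 ^+ (2 * j) * V q r ^+ 2.
  rewrite (bigD1_seq 1%N) ?iota_uniq ?mem_index_iota//=.
  rewrite rellich_coef_bot// lerDl sumr_ge0// => j _.
  rewrite mulr_ge0 ?sqr_ge0// mulr_ge0//; first by apply: rellich_coef_ge0 => //; lia.
  by rewrite exprn_ge0// invr_ge0 ltW.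
rewrite -subr_ge0; move: le1 (c1); rewrite -subr_ge0 => le1 /mulr_ge0 /(_ le1).
set S := \sum_(_ <= _ < _) _ => le2; apply: le_trans le2 _.
rewrite le_eqVlt; apply/orP; left; apply/eqP.
rewrite muln1 mulnS exprD /=; move: (a ^+ (4 * p)) (_ ^+ (2 * p)) => x y; ring.
Qed.

(** The coefficient of V_h^2 / r^(2j) in the lower bound for (V_(h+p)')^2: the
    Poincare part of the Hardy inequality contributes for j = 1 only, its
    1/(4 r^2) part contributes for every j between 1 and 2p + 1. *)
Definition gradient_coef (p j : nat) : R :=
  a ^+ 2 * poincare_rellich_coef N p * (j == 1%N)%:R + 4^-1 * rellich_coef N p 1 j.

Definition hardy_coef (p h i : nat) : R :=
  \sum_(1 <= j < (2 * p + 1).+1) gradient_coef p j * rellich_coef N h j i.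

Lemma poincare_rellich_coef_ge0 p : 0 <= poincare_rellich_coef N p :> R.
Proof.
have d1 : 0 <= d - 1 by rewrite subr_ge0 ler1n; lia.
elim: p => [|p IH] //=.
apply: addr_ge0; first by rewrite mulr_ge0// exprn_even_ge0.
by rewrite mulr_ge0 ?exprn_ge0// divr_ge0// mulr_ge0.
Qed.

Lemma gradient_coef_gt0 p j : (2 + 4 * p < N)%N -> (1 <= j <= 2 * p + 1)%N ->
  0 < gradient_coef p j.
Proof.
move=> pN jp; apply: ltr_wpDl.
  by rewrite mulr_ge0// mulr_ge0 ?sqr_ge0// poincare_rellich_coef_ge0.
by rewrite mulr_gt0// rellich_coef_gt0//; lia.
Qed.

Lemma hardy_coef_gt0 p h i : (2 * (2 * p + 1) + 4 * h < N)%N ->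
  (1 <= i <= 2 * p + 1 + 2 * h)%N -> 0 < hardy_coef p h i.
Proof.
move=> hN ip.
(* h Rellich steps lead from the exponent j to i when j <= i <= j + 2h. *)
have [j jp ij] : exists2 j, (1 <= j <= 2 * p + 1)%N & (j <= i <= j + 2 * h)%N.
  by have [ih|ih] := leqP i (2 * h); [exists 1%N|exists (i - 2 * h)%N]; lia.
rewrite /hardy_coef (bigD1_seq j) ?iota_uniq ?mem_index_iota//=.
apply: ltr_wpDr.
  rewrite big_seq_cond; apply: sumr_ge0 => j'; rewrite mem_index_iota => /andP[jp' _].
  by rewrite mulr_ge0 ?(ltW (gradient_coef_gt0 _ _))// ?rellich_coef_ge0//; lia.
rewrite mulr_gt0 ?gradient_coef_gt0//; first lia.
by apply: rellich_coef_gt0 => //; lia.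
Qed.

Lemma hardy_coef_top p h :
  hardy_coef p h (2 * p + 1 + 2 * h) =
  C_top N (2 * p + 1) * Xi_zero N (2 * (2 * p + 1))%:R h.
Proof.
rewrite /hardy_coef (bigD1_seq (2 * p + 1)%N) ?iota_uniq ?mem_index_iota//=; [|lia..].
rewrite rellich_coef_top// big_seq_cond big1 ?addr0; last first.
  move=> j; rewrite mem_index_iota => /andP[jp /eqP jn].
  by rewrite (@rellich_coef_eq0 _ _ _ h) ?mulr0//; lia.
rewrite C_topE; congr (_ * _).
rewrite /gradient_coef [X in rellich_coef _ _ _ X]addnC rellich_coef_top// muln1.
by case: p => [|p]; rewrite ?mulr0 ?mul0r ?add0r// addn1 mulr0 add0r.
Qed.

Lemma hardy_coef_bot p h :
  hardy_coef p h 1 = C_one N (2 * p + 1) * Xi_top N 2 h.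
Proof.
rewrite /hardy_coef (bigD1_seq 1%N) ?iota_uniq ?mem_index_iota//=; [|lia..].
rewrite rellich_coef_bot// big_seq_cond big1 ?addr0; last first.
  move=> j; rewrite mem_index_iota => /andP[jp /eqP jn].
  by rewrite (@rellich_coef_eq0 _ _ _ h) ?mulr0//; lia.
by rewrite /gradient_coef rellich_coef_bot// eqxx mulr1 -C_oneE.
Qed.

(** Hardy's inequality for V_(h+p), then p steps down to V_h, both for the
    function itself and for its quotient by r^2, and finally h weighted Rellich
    steps down to V_0 for each power of 1/r obtained. *)
Theorem ray_inequality p h : (2 * (2 * p + 1) + 4 * h < N)%N ->
  nonneg_up_to_exact (fun r => V1 (h + p) r ^+ 2
    - (a ^+ (4 * p + 2) * V h r ^+ 2
       + \sum_(1 <= i < (2 * p + 1 + 2 * h).+1)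
            hardy_coef p h i * r^-1 ^+ (2 * i) * V 0 r ^+ 2)).
Proof.
move=> hN.
have S0 := poincare_hardy N2 (@dV (h + p)) (@dV1 (h + p)) (@dV2 (h + p)) (@V_supp (h + p)).
have I0 := nonneg_up_to_exactZ (sqr_ge0 a) (@iterated_poincare_rellich p h ltac:(lia)).
have c1 : 0 <= 4^-1 :> R by [].
have I1 := nonneg_up_to_exactZ c1 (@iterated_rellich p 1 h (2 * p + 1).+1 ltac:(lia) ltac:(lia)).
have I2 : nonneg_up_to_exact (fun r => \sum_(j <- index_iota 1 (2 * p + 1).+1)
   gradient_coef p j * (r^-1 ^+ (2 * j) * V h r ^+ 2
     - \sum_(0 <= i < (2 * p + 1 + 2 * h).+1)
         rellich_coef N h j i * r^-1 ^+ (2 * i) * V 0 r ^+ 2)).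
  apply: nonneg_up_to_exact_sum => j; rewrite mem_index_iota => jp.
  apply: nonneg_up_to_exactZ; first by apply/ltW/gradient_coef_gt0; lia.
  by have := @iterated_rellich h j 0 (2 * p + 1 + 2 * h).+1 ltac:(lia) ltac:(lia).
apply: nonneg_up_to_exact_ge (nonneg_up_to_exactD S0
  (nonneg_up_to_exactD I0 (nonneg_up_to_exactD I1 I2))) => r r0.
rewrite le_eqVlt; apply/orP; left; apply/eqP.
have -> : \sum_(1 <= i < (2 * p + 1 + 2 * h).+1)
    hardy_coef p h i * r^-1 ^+ (2 * i) * V 0 r ^+ 2 =
  \sum_(1 <= j < (2 * p + 1).+1) gradient_coef p j *
    \sum_(0 <= i < (2 * p + 1 + 2 * h).+1)
      rellich_coef N h j i * r^-1 ^+ (2 * i) * V 0 r ^+ 2.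
  under [RHS]eq_bigr do rewrite big_distrr/=.
  rewrite [RHS]exchange_big/= [RHS]big_nat_recl//= [X in _ = X + _]big_nat.
  rewrite [X in _ = X + _]big1 ?add0r.
    rewrite big_add1/=; apply: eq_bigr => i _; rewrite /hardy_coef !big_distrl/=.
    by apply: eq_bigr => j _; rewrite !mulrA.
  by move=> j jp; rewrite rellich_coef_eq0 ?mul0r ?mulr0//; lia.
under [X in _ + (_ + (_ + X))]eq_bigr do rewrite mulrBr.
rewrite sumrB.
have -> : \sum_(1 <= j < (2 * p + 1).+1) gradient_coef p j * (r^-1 ^+ (2 * j) * V h r ^+ 2) =
  a ^+ 2 * poincare_rellich_coef N p * r^-1 ^+ 2 * V h r ^+ 2
  + 4^-1 * \sum_(0 <= j < (2 * p + 1).+1) rellich_coef N p 1 j * r^-1 ^+ (2 * j) * V h r ^+ 2.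
  rewrite [in RHS]big_nat_recl// rellich_coef_eq0// !mul0r add0r.
  rewrite (eq_bigr (fun j => a ^+ 2 * poincare_rellich_coef N p * (j == 1%N)%:R
     * (r^-1 ^+ (2 * j) * V h r ^+ 2) + 4^-1 * (rellich_coef N p 1 j
     * r^-1 ^+ (2 * j) * V h r ^+ 2))); last first.
    by move=> j _; rewrite /gradient_coef mulrDl !mulrA.
  rewrite big_split/=; congr (_ + _); last by rewrite -big_distrr/= big_add1.
  rewrite (bigD1_seq 1%N) ?iota_uniq ?mem_index_iota//=; [|lia..].
  rewrite big1 ?addr0; first by rewrite muln1 mulr1 !mulrA.
  by move=> j /negPf->; rewrite mulr0 mul0r.
rewrite exprD muln1; set S := \sum_(0 <= j < _) _; set T := \sum_(1 <= j < _) _.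
by move: (a ^+ (4 * p)) => x; field; rewrite gt_eqF.
Qed.

End IteratedLaplacian.

(** * Functions that are smooth along rays *)

Section MeasurableVec.
Context {R : realType} (N : nat).
Local Notation mR := (measurableTypeR R).

(** Countably many boxes suffice to write an open set as a union, which reduces
    measurability of a continuous function of a tuple to its coordinates. *)
Lemma open_rational_box (U : set 'rV[R]_N) (x : 'rV[R]_N) : open U -> U x ->
  exists q : {ffun 'I_N -> rat} * nat,
    (forall i, `|x ord0 i - ratr (q.1 i)| < q.2.+1%:R^-1) /\
    (forall y : 'rV[R]_N, (forall i, `|y ord0 i - ratr (q.1 i)| < q.2.+1%:R^-1) -> U y).
Proof.
move=> oU Ux; have /nbhs_ballP[e /= e0 eU] := open_nbhs_nbhs (conj oU Ux).
have e20 : 0 < e / 2 by rewrite divr_gt0.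
have [n _ /(_ n (leqnn n)) /= ne] := near_infty_natSinv_lt (PosNum e20).
have n0 : 0 < n.+1%:R^-1 :> R by rewrite invr_gt0.
have qP i : {q : rat | `|x ord0 i - ratr q| < n.+1%:R^-1}.
  move: (n.+1%:R^-1) n0 => c c0; apply: cid; have /rat_in_itvoo[q] : x ord0 i - c < x ord0 i + c.
    by rewrite ltrBlDr -addrA ltrDl addr_gt0.
  by rewrite in_itv/= => /andP[q1 q2]; exists q; rewrite ltr_norml; apply/andP; split; lra.
exists ([ffun i => sval (qP i)], n); split => [i|y yq] /=.
  by rewrite ffunE; case: (qP i).
apply: eU; split => // i j; rewrite !ord1 {i}.
have := yq j; rewrite /= ffunE; case: (qP j) => q /= xq yqj.
move: (n.+1%:R^-1) ne xq yqj => c ce xq yqj.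
rewrite /ball/= ltr_norml; move: xq yqj; rewrite !ltr_norml.
by move=> /andP[? ?] /andP[? ?]; apply/andP; split; lra.
Qed.

Lemma continuous_measurable_vec (f : 'rV[R]_N -> R) : continuous f ->
  measurable_fun setT (fun t : N.-tuple mR => f (vec t) : mR).
Proof.
move=> /continuousP cf; apply: (measurability _ (RGenOInfty.measurableE R)).
move=> _ [_ [a ->] <-]; rewrite setTI.
have oU : open (f @^-1` `]a, +oo[%classic) by apply: cf; exact: interval_open.
set U := f @^-1` _ in oU *.
pose box (q : {ffun 'I_N -> rat} * nat) : set (N.-tuple mR) :=
  [set t | forall i, `|vec t ord0 i - ratr (q.1 i)| < q.2.+1%:R^-1].
pose F q := if pselect (forall t, box q t -> U (vec t)) then box q else set0.
have -> : (fun t : N.-tuple mR => f (vec t)) @^-1` `]a, +oo[%classic = \bigcup_q F q.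
  apply/seteqP; split => [t Ut|t [q _]]; last first.
    by rewrite /F; case: pselect => // qU /qU.
  have [q [tq qU]] := open_rational_box oU Ut.
  by exists q => //; rewrite /F; case: pselect => // -[] t' /qU.
apply: countable_bigcupT_measurable => [|q]; first exact: countableP.
rewrite /F; case: pselect => //= _.
have -> : box q = \bigcap_(i in [set` index_enum 'I_N])
    ((fun t : N.-tuple mR => (vec t ord0 i : mR)) @^-1`
       `](ratr (q.1 i) - q.2.+1%:R^-1), (ratr (q.1 i) + q.2.+1%:R^-1)[%classic).
  apply/seteqP; split => [t tq i _|t tq i] /=.
    have := tq i; set c := (q.2.+1%:R^-1 : R); rewrite ltr_norml in_itv/=.
    by move=> /andP[? ?]; apply/andP; split; lra.
  have := tq i (mem_index_enum i); set c := (q.2.+1%:R^-1 : R).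
  rewrite /= in_itv/= ltr_norml => /andP[? ?].
  by apply/andP; split; lra.
rewrite bigcap_seq.
apply: bigsetI_measurable => i _; rewrite -[X in measurable X]setTI.
exact: measurable_vec.
Qed.

Lemma measurable_scale_vec (f : 'rV[R]_N -> R) : continuous f ->
  measurable_fun setT (fun p : mR * N.-tuple mR => f ((p.1 : R) *: vec p.2) : mR).
Proof.
move=> cf; pose s (p : mR * N.-tuple mR) : N.-tuple mR :=
  [tuple (p.1 * tnth p.2 i : R) | i < N].
rewrite (_ : (fun _ => _) = (fun t => f (vec t) : mR) \o s); last first.
  apply/funext => p /=; congr f; apply/rowP => i.
  by rewrite !mxE tnth_mktuple.
apply: measurableT_comp; first exact: continuous_measurable_vec.
apply/measurable_fun_tnthP => i.
rewrite (_ : _ \o _ = (fun p : mR * N.-tuple mR => (p.1 : R) * tnth p.2 i)); last first.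
  by apply/funext => p /=; rewrite tnth_mktuple.
apply: measurable_funM; first exact: measurable_fst.
exact: measurableT_comp (measurable_tnth i) measurable_snd.
Qed.

End MeasurableVec.

Section RaySmooth.
Context {R : realType} (N : nat) (A B : R) (A0 : 0 < A).
Local Notation mR := (measurableTypeR R).
Implicit Types (f g : 'rV[R]_N -> R) (w : 'rV[R]_N) (r : R).

Definition polar_domain : set (mR * N.-tuple mR) :=
  `]0, +oo[%classic `*` sphere (N := N).

Definition ray_measurable f :=
  measurable_fun polar_domain
    (fun p : mR * N.-tuple mR => f ((p.1 : R) *: vec p.2) : mR).

Definition annulus_bounded f := exists M, forall w r,
  polar_radius w = 1 -> A <= r <= B -> `|f (r *: w)| <= M.

Definition ray_derivative_of f g := forall w r,
  polar_radius w = 1 -> 0 < r -> is_derive r 1 (fun t : R => f (t *: w)) (g (r *: w)).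

(** n-fold differentiability along rays, where every derivative is jointly
    measurable in (r, w) and bounded on the annulus A <= r <= B uniformly in w.
    Unlike smoothness in x, it is visibly stable under the radial operators,
    and it is all that Tonelli's theorem and finiteness require. *)
Fixpoint ray_smooth (n : nat) f : Prop :=
  (ray_measurable f /\ annulus_bounded f) /\
  if n is n'.+1 then exists2 g, ray_derivative_of f g & ray_smooth n' g else True.

Lemma polar_radiusZ w r : 0 <= r -> polar_radius (r *: w) = r * polar_radius w.
Proof.
move=> r0; rewrite /polar_radius.
rewrite (eq_bigr (fun i => r ^+ 2 * w ord0 i ^+ 2)) => [|i _].
  by rewrite -big_distrr/= sqrtrM ?sqr_ge0// sqrtr_sqr ger0_norm.
by rewrite mxE exprMn.
Qed.

Lemma polar_radius_ray w r : polar_radius w = 1 -> 0 < r -> polar_radius (r *: w) = r.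
Proof. by move=> w1 r0; rewrite polar_radiusZ ?ltW// w1 mulr1. Qed.

Lemma polar_direction_ray w r : polar_radius w = 1 -> 0 < r -> polar_direction (r *: w) = w.
Proof.
move=> w1 r0; rewrite /polar_direction polar_radius_ray// scalerA mulVf ?scale1r//.
by rewrite gt_eqF.
Qed.

Lemma measurable_polar_domain : measurable polar_domain.
Proof.
apply: measurableX; first exact: measurable_itv.
rewrite (_ : sphere (N := N) =
  (fun t : N.-tuple mR => (polar_radius (vec t) : mR)) @^-1` [set 1])//.
by rewrite -[X in measurable X]setTI; apply: measurable_polar_radius.
Qed.

Lemma ray_measurable_ext f g :
  (forall w r, polar_radius w = 1 -> 0 < r -> f (r *: w) = g (r *: w)) ->
  ray_measurable f -> ray_measurable g.
Proof.
move=> fg; apply: eq_measurable_fun => -[r t]; rewrite inE => -[/= + t1].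
by rewrite in_itv/= andbT => r0; rewrite fg.
Qed.

Lemma ray_smooth_ext n f g :
  (forall w r, polar_radius w = 1 -> 0 < r -> f (r *: w) = g (r *: w)) ->
  ray_smooth n f -> ray_smooth n g.
Proof.
move=> fg; have base : ray_measurable f /\ annulus_bounded f ->
    ray_measurable g /\ annulus_bounded g.
  move=> [mf [M fM]]; split; first exact: ray_measurable_ext mf.
  exists M => w r w1 rAB; rewrite -fg ?fM//.
  by move/andP: rAB => [Ar _]; exact: lt_le_trans Ar.
case: n => [[/base]|n [/base bg [h fh nh]]]; split => //.
exists h => // w r w1 r0.
apply: near_eq_is_derive (fh w r w1 r0).
have : \forall t \near r, 0 < t by exact: lt_nbhsr.
by apply: filterS => t t0; exact: fg.
Qed.

Lemma ray_smoothW n f : ray_smooth n.+1 f -> ray_smooth n f.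
Proof.
elim: n f => [|n IH] f [bf [g fg ng]]; split => //.
by exists g => //; exact: IH.
Qed.

Lemma ray_smooth_cst n (c : R) : ray_smooth n (fun=> c).
Proof.
elim: n c => [|n IH] c; (split; [split; [exact: measurable_cst|by exists `|c|]|]) => //.
by exists (fun=> 0) => // w r _ _; exact: is_derive_fct_cst.
Qed.

Lemma ray_smoothD n f g : ray_smooth n f -> ray_smooth n g ->
  ray_smooth n (fun x => f x + g x).
Proof.
have base f' g' : ray_measurable f' /\ annulus_bounded f' ->
    ray_measurable g' /\ annulus_bounded g' ->
    ray_measurable (fun x => f' x + g' x) /\ annulus_bounded (fun x => f' x + g' x).
  move=> [mf [K fK]] [mg [L gL]]; split; first exact: measurable_funD.
  by exists (K + L) => w r w1 rAB; rewrite (le_trans (ler_normD _ _))// lerD ?fK ?gL.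
elim: n f g => [|n IH] f g [bf nf] [bg ng]; split => //; try exact: base.
move: nf ng => [f1 ff1 nf1] [g1 gg1 ng1].
exists (fun x => f1 x + g1 x); last exact: IH.
by move=> w r w1 r0; apply: is_derive_fctD; [exact: ff1|exact: gg1].
Qed.

Lemma ray_smoothM n f g : ray_smooth n f -> ray_smooth n g ->
  ray_smooth n (fun x => f x * g x).
Proof.
have base f' g' : ray_measurable f' /\ annulus_bounded f' ->
    ray_measurable g' /\ annulus_bounded g' ->
    ray_measurable (fun x => f' x * g' x) /\ annulus_bounded (fun x => f' x * g' x).
  move=> [mf [K fK]] [mg [L gL]]; split; first exact: measurable_funM.
  by exists (K * L) => w r w1 rAB; rewrite normrM ler_pM ?fK ?gL.
elim: n f g => [|n IH] f g; first by move=> [bf _] [bg _]; split => //; exact: base.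
move=> sf sg; have := sf; have := sg => -[bg [g1 gg1 ng1]] [bf [f1 ff1 nf1]].
split; first exact: base.
exists (fun x => f1 x * g x + f x * g1 x).
  by move=> w r w1 r0; apply: is_derive_fctM; [exact: ff1|exact: gg1].
by apply: ray_smoothD; apply: IH => //; exact: ray_smoothW.
Qed.

Lemma ray_smoothX n j f : ray_smooth n f -> ray_smooth n (fun x => f x ^+ j).
Proof.
move=> sf; elim: j => [|j IH].
  by apply: ray_smooth_ext (ray_smooth_cst n 1) => w r _ _; rewrite expr0.
by apply: ray_smooth_ext (ray_smoothM sf IH) => w r _ _; rewrite exprS.
Qed.

Lemma ray_smooth_measurable n f : ray_smooth n f -> ray_measurable f.
Proof. by case: n => [|n] [[]]. Qed.

Lemma ray_smooth_continuous n f w r : ray_smooth n.+1 f ->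
  polar_radius w = 1 -> 0 < r -> {for r, continuous (fun t : R => f (t *: w))}.
Proof. by move=> [_ [g fg _]] w1 r0; exact: is_derive_continuous (fg w r w1 r0). Qed.

Lemma ray_smooth_sum n (I : Type) (s : seq I) (F : I -> 'rV[R]_N -> R) :
  (forall i, ray_smooth n (F i)) -> ray_smooth n (fun x => \sum_(i <- s) F i x).
Proof.
move=> sF; elim: s => [|i s IH].
  by apply: ray_smooth_ext (ray_smooth_cst n 0) => w r _ _; rewrite big_nil.
by apply: ray_smooth_ext (ray_smoothD (sF i) IH) => w r _ _; rewrite big_cons.
Qed.

(** Boundedness comes from compactness of [A, B], which stays away from the pole
    where coth r and 1/r blow up. *)
Lemma ray_base_radial (phi : R -> R) : (forall r, 0 < r -> {for r, continuous phi}) ->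
  ray_measurable (fun x => phi (polar_radius x)) /\
  annulus_bounded (fun x => phi (polar_radius x)).
Proof.
move=> cphi; split.
  have : measurable_fun polar_domain (phi \o fst : mR * N.-tuple mR -> mR).
    apply: (@measurable_comp _ _ _ _ _ _ (`]0, +oo[%classic : set mR)).
    - exact: measurable_itv.
    - by move=> _ [[r t] [/= r0 _] <-].
    - apply: open_continuous_measurable_fun; first exact: interval_open.
      by move=> r; rewrite inE/= in_itv/= andbT => /cphi.
    - exact: measurable_funTS measurable_fst.
  apply: eq_measurable_fun => -[r t]; rewrite inE => -[/= + t1].
  by rewrite in_itv/= andbT => r0; rewrite polar_radius_ray.
have [AB|BA] := leP A B; last first.
  by exists 0 => w r _ /andP[Ar rB]; move: (lt_le_trans BA Ar); rewrite ltNge rB.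
have cAB : {within `[A, B], continuous (fun r => `|phi r|)}.
  apply: continuous_in_subspaceT => r; rewrite inE/= in_itv/= => /andP[Ar _].
  apply: (@continuous_comp _ _ _ phi (fun y : R => `|y|)).
    exact/cphi/(lt_le_trans A0).
  exact: norm_continuous.
have [c _ cM] := EVT_max AB cAB.
exists `|phi c| => w r w1 rAB; rewrite polar_radius_ray// ?cM ?in_itv//.
by move/andP: rAB => [Ar _]; exact: lt_le_trans Ar.
Qed.

Lemma ray_smooth_inv_radius n : ray_smooth n (fun x => (polar_radius x)^-1).
Proof.
have base := @ray_base_radial (fun y => y^-1) (fun r (r0 : 0 < r) =>
  is_derive_continuous (is_derive_inv_id (lt0r_neq0 r0))).
elim: n => [|n IH]; split => //.
exists (fun x => (-1) * ((polar_radius x)^-1 * (polar_radius x)^-1)); last first.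
  by apply: ray_smoothM; [exact: ray_smooth_cst|exact: ray_smoothM].
move=> w r w1 r0; rewrite polar_radius_ray//.
apply: near_eq_is_derive (is_derive_eq (is_derive_inv_id (lt0r_neq0 r0)) _).
  have : \forall t \near r, 0 < t by exact: lt_nbhsr.
  by apply: filterS => t t0; rewrite polar_radius_ray.
by rewrite mulN1r.
Qed.

Lemma ray_smooth_coth_radius n : ray_smooth n (fun x => coth (polar_radius x)).
Proof.
have base := @ray_base_radial coth (fun r (r0 : 0 < r) => is_derive_continuous (is_derive_coth r0)).
elim: n => [|n IH]; split => //.
exists (fun x => 1 + (-1) * (coth (polar_radius x) * coth (polar_radius x))); last first.
  apply: ray_smoothD; first exact: ray_smooth_cst.
  by apply: ray_smoothM; [exact: ray_smooth_cst|exact: ray_smoothM].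
move=> w r w1 r0; rewrite polar_radius_ray//.
apply: near_eq_is_derive (is_derive_eq (is_derive_coth r0) _).
  have : \forall t \near r, 0 < t by exact: lt_nbhsr.
  by apply: filterS => t t0; rewrite polar_radius_ray.
by rewrite mulN1r expr2.
Qed.

Lemma coord_le_polar_radius (x : 'rV[R]_N) i : `|x ord0 i| <= polar_radius x.
Proof.
rewrite -sqrtr_sqr ler_wsqrtr// (bigD1 i)//= lerDl.
by apply: sumr_ge0 => j _; exact: sqr_ge0.
Qed.

(** The direction is constant along a ray, so its coordinates have derivative 0. *)
Lemma ray_smooth_direction n i : ray_smooth n (fun x => polar_direction x ord0 i).
Proof.
have base : ray_measurable (fun x => polar_direction x ord0 i) /\
    annulus_bounded (fun x => polar_direction x ord0 i).
  split.
    have : measurable_fun polar_domain (fun p : mR * N.-tuple mR => (vec p.2 ord0 i : mR)).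
      exact: measurable_funTS (measurableT_comp (measurable_vec i) measurable_snd).
    apply: eq_measurable_fun => -[r t]; rewrite inE => -[/= + t1].
    by rewrite in_itv/= andbT => r0; rewrite polar_direction_ray.
  exists 1 => w r w1 /andP[Ar _].
  by rewrite polar_direction_ray ?(lt_le_trans A0)// -w1 coord_le_polar_radius.
case: n => [|n]; split => //.
exists (fun=> 0); last exact: ray_smooth_cst.
move=> w r w1 r0; apply: near_eq_is_derive (is_derive_fct_cst r (w ord0 i)).
have : \forall t \near r, 0 < t by exact: lt_nbhsr.
by apply: filterS => t t0; rewrite polar_direction_ray.
Qed.

(** The annulus lies in the compact cube with sides [-B, B]. *)
Lemma ray_base_continuous f : continuous f -> ray_measurable f /\ annulus_bounded f.
Proof.
move=> cf; split; first exact: measurable_funTS (measurable_scale_vec cf).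
have cK := @rV_compact _ N (fun=> `[-B, B]%classic) (fun=> @segment_compact _ _ _).
have := compact_bounded (continuous_compact (continuous_subspaceT cf) cK).
move=> [M [_ fM]]; exists (M + 1) => w r w1 /andP[Ar rB].
apply: (fM (M + 1)); first by rewrite ltrDl.
exists (r *: w) => // i; rewrite /= in_itv/= -ler_norml.
by rewrite (le_trans (coord_le_polar_radius _ _))// polar_radius_ray// (lt_le_trans A0).
Qed.

Lemma is_derive_ray f w r : differentiable f (r *: w) ->
  is_derive r 1 (fun t : R => f (t *: w)) ('D_w f (r *: w)).
Proof.
move=> df; have E : (fun h : R => h^-1 *: (f ((h *: 1 + r) *: w) - f (r *: w))) =
    (fun h : R => h^-1 *: (f (h *: w + r *: w) - f (r *: w))).
  by apply/funext => h; rewrite scalerDl /GRing.scale/= mulr1.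
split.
  have := @diff_derivable _ _ _ f (r *: w) w df.
  by rewrite /derivable/= -E.
by rewrite /derive/= E.
Qed.

Lemma smooth_derive (u : 'rV[R]_N -> R) v : smooth u -> smooth ('D_v u).
Proof. by move=> su vs x; have := su (rcons vs v) x; rewrite foldr_rcons. Qed.

Lemma derive_row f (v x : 'rV[R]_N) : differentiable f x ->
  'D_v f x = \sum_(i < N) v ord0 i * 'D_(delta_mx ord0 i) f x.
Proof.
move=> df; rewrite deriveE// {1}(row_sum_delta v) linear_sum/=.
by apply: eq_bigr => i _; rewrite linearZ/= deriveE.
Qed.

(** The derivative of u along the ray of direction w is the sum of the
    w_i d_i u, so that the induction can be applied to the smooth functions
    d_i u. *)
Lemma ray_smooth_smooth n (u : 'rV[R]_N -> R) : smooth u -> ray_smooth n u.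
Proof.
elim: n u => [|n IH] u su; have cu : continuous u by
  move=> x; exact/differentiable_continuous/(su [::]).
  by split => //; exact: ray_base_continuous.
split; first exact: ray_base_continuous.
exists (fun x => \sum_(i < N) polar_direction x ord0 i * 'D_(delta_mx ord0 i) u x).
  move=> w r w1 r0; apply: is_derive_eq (is_derive_ray (su [::] _)) _.
  by rewrite derive_row ?polar_direction_ray//; exact: (su [::]).
apply: ray_smooth_sum => i; apply: ray_smoothM; first exact: ray_smooth_direction.
exact/IH/smooth_derive.
Qed.

Lemma radial_derivativeE f g : ray_derivative_of f g ->
  forall w r, polar_radius w = 1 -> 0 < r -> radial_derivative f (r *: w) = g (r *: w).
Proof.
move=> fg w r w1 r0; rewrite /radial_derivative polar_radius_ray// polar_direction_ray//.
by rewrite derive1E; exact: (@derive_val _ _ _ _ _ _ _ (fg w r w1 r0)).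
Qed.

Lemma ray_smooth_radial_derivative n f : ray_smooth n.+1 f ->
  ray_smooth n (radial_derivative f).
Proof.
move=> [_ [g fg sg]]; apply: ray_smooth_ext sg => w r w1 r0.
by rewrite (radial_derivativeE fg).
Qed.

Lemma is_derive_radial_derivative n f w r : ray_smooth n.+1 f ->
  polar_radius w = 1 -> 0 < r ->
  is_derive r 1 (fun t : R => f (t *: w)) (radial_derivative f (r *: w)).
Proof. by move=> [_ [g fg _]] w1 r0; rewrite (radial_derivativeE fg)//; exact: fg. Qed.

Lemma ray_smooth_radial_laplacian n f : ray_smooth n.+2 f ->
  ray_smooth n (radial_laplacian f).
Proof.
move=> sf; have s1 := ray_smooth_radial_derivative sf.
apply: ray_smoothD; first exact: ray_smooth_radial_derivative.
apply: ray_smoothM; last exact: ray_smoothW.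
by apply: ray_smoothM; [exact: ray_smooth_cst|exact: ray_smooth_coth_radius].
Qed.

Lemma ray_smooth_iter_laplacian n j (u : 'rV[R]_N -> R) : smooth u ->
  ray_smooth n (iter j radial_laplacian u).
Proof.
move=> su; elim: j n => [|j IH] n; first exact: ray_smooth_smooth.
exact: ray_smooth_radial_laplacian.
Qed.

End RaySmooth.

(** * Supports *)

Section RayVanish.
Context {R : realType} (N : nat) (A B : R).
Implicit Types (f : 'rV[R]_N -> R).

Definition ray_vanish f := forall (w : 'rV[R]_N) (r : R),
  polar_radius w = 1 -> 0 < r -> ~~ (A <= r <= B) -> f (r *: w) = 0.

Lemma ray_vanish_radial_derivative f : ray_vanish f -> ray_vanish (radial_derivative f).
Proof.
move=> f0 w r w1 r0 rAB.
rewrite /radial_derivative polar_radius_ray// polar_direction_ray// derive1E.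
rewrite (_ : 'D_1 _ r = 'D_1 (fun=> 0 : R) r); first exact: derive_cst.
apply: near_eq_derive.
have near0 : \forall t \near r, 0 < t by exact: lt_nbhsr.
have nearAB : \forall t \near r, ~~ (A <= t <= B).
  move: rAB; rewrite negb_and -!ltNge => /orP[rA|Br].
    have : \forall t \near r, t < A by exact: lt_nbhsl.
    by apply: filterS => t tA; rewrite negb_and -!ltNge tA.
  have : \forall t \near r, B < t by exact: lt_nbhsr.
  by apply: filterS => t tB; rewrite negb_and -!ltNge tB orbT.
by apply: filterS2 near0 nearAB => t t0 tAB; rewrite f0.
Qed.

Lemma ray_vanish_iter_laplacian j f : ray_vanish f ->
  ray_vanish (iter j radial_laplacian f).
Proof.
move=> f0; elim: j => [//|j IH] w r w1 r0 rAB; rewrite iterS /radial_laplacian.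
have IH1 := ray_vanish_radial_derivative IH.
by rewrite (ray_vanish_radial_derivative IH1)// IH1// mulr0 addr0.
Qed.

End RayVanish.

(** The support is bounded and, being closed, stays at positive distance from the
    pole; the Euclidean radius is compared with the sup norm on both sides. *)
Lemma test_function_annulus {R : realType} (N : nat) (u : 'rV[R]_N -> R) :
  test_function u -> exists A B : R, [/\ 0 < A, A <= B & ray_vanish A B u].
Proof.
move=> [_ cK K0]; set K := closure _ in cK K0.
have K0' : nbhs (0 : 'rV[R]_N) (~` K).
  by apply: open_nbhs_nbhs; split => //; exact/closed_openC/closed_closure.
have [e /= e0 eK] := (nbhs_ballP _ _).1 K0'.
have [M [_ KM]] := compact_bounded cK.
pose B := Num.sqrt (N%:R * (M + 1) ^+ 2).
exists e, (Num.max e B); split => //; first by rewrite le_max lexx.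
move=> w r w1 r0; apply: contraNeq => u0.
have Kx : K (r *: w) by apply: subset_closure.
apply/andP; split.
  rewrite leNgt; apply/negP => re; apply: (eK (r *: w)) => //; split => // i j.
  rewrite !ord1 /ball/= mxE sub0r normrN (le_lt_trans _ re)//.
  by rewrite -[leRHS](polar_radius_ray w1 r0) coord_le_polar_radius.
rewrite le_max; apply/orP; right.
rewrite -[leLHS](polar_radius_ray w1 r0) ler_wsqrtr//.
have -> : N%:R * (M + 1) ^+ 2 = \sum_(i < N) (M + 1) ^+ 2.
  by rewrite sumr_const card_ord mulr_natl.
apply: ler_sum => i _; have := KM (M + 1); rewrite ltrDl ltr01 => /(_ isT _ Kx).
rewrite /= => xM; have M0 := le_trans (normr_ge0 _) xM.
rewrite -real_normK ?num_real//; apply: lerXn2r; rewrite ?nnegrE//.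
apply: le_trans xM; rewrite [leRHS]mx_normrE.
exact: (le_bigmax _ (fun ij => `|(r *: w) ij.1 ij.2|) (ord0, i)).
Qed.

(** * Integration along rays and over the hyperbolic space *)

Section RayIntegral.
Context {R : realType} (N : nat) (A B : R) (A0 : 0 < A) (AB : A <= B).
Local Notation mR := (measurableTypeR R).
Local Notation mu := (@lebesgue_measure R).
Implicit Types F : R -> R.

(** The interval is slightly larger than [A, B], so that functions vanishing off
    [A, B] vanish at its end points. *)
Lemma integral_ray_restrict F : (forall r : R, 0 < r -> ~~ (A <= r <= B) -> F r = 0) ->
  (\int[mu]_(r in `]0%R, +oo[%classic) (F r * sinh r ^+ N.-1)%R%:E =
   \int[mu]_(r in `[(A / 2)%R, (B + 1)%R]%classic) (F r * sinh r ^+ N.-1)%R%:E)%E.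
Proof.
move=> F0; have A0' := A0; have A20 : 0 < A / 2 by lra.
have widen (r : R) : A <= r <= B -> A / 2 <= r <= B + 1.
  by move=> /andP[? ?]; apply/andP; split; lra.
rewrite integral_mkcond [RHS]integral_mkcond.
apply: eq_integral => r _; rewrite /patch !mem_setE !in_itv/= andbT.
have [r0|r0] := ltP 0 r; last first.
  rewrite /=; case: ifP => // /andP[Ar _].
  by have := lt_le_trans A20 (le_trans Ar r0); rewrite ltxx.
rewrite /=; case: ifPn => // rAB; rewrite F0 ?mul0r//.
exact: contra (widen r) rAB.
Qed.

(** The fundamental theorem of calculus kills the exact derivative. *)
Lemma integral_nonneg_up_to_exact F1 F2 :
  (forall r : R, 0 < r -> {for r, continuous F1}) ->
  (forall r : R, 0 < r -> {for r, continuous F2}) ->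
  (forall r : R, 0 < r -> ~~ (A <= r <= B) -> F1 r = 0) ->
  (forall r : R, 0 < r -> ~~ (A <= r <= B) -> F2 r = 0) ->
  nonneg_up_to_exact N A B (fun r => F2 r - F1 r) ->
  (\int[mu]_(r in `]0%R, +oo[%classic) (F1 r * sinh r ^+ N.-1)%R%:E <=
   \int[mu]_(r in `]0%R, +oo[%classic) (F2 r * sinh r ^+ N.-1)%R%:E)%E.
Proof.
move=> c1 c2 v1 v2; have A0' := A0; have AB' := AB; move=> [G [g [dG cg G0 gF]]].
rewrite !integral_ray_restrict//.
set I := `[A / 2, B + 1]%classic.
have I0 r : I r -> 0 < r by rewrite /I/= in_itv/= => /andP[? _]; lra.
have intg F : (forall r : R, 0 < r -> {for r, continuous F}) ->
    mu.-integrable I (EFin \o F).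
  move=> cF; apply: continuous_compact_integrable; first exact: segment_compact.
  by apply: continuous_in_subspaceT => r; rewrite inE => /I0/cF.
have cs F : (forall r : R, 0 < r -> {for r, continuous F}) ->
    forall r : R, 0 < r -> {for r, continuous (fun r => F r * sinh r ^+ N.-1)}.
  move=> cF r r0; apply: cvgM; first exact: cF.
  exact: is_derive_continuous (is_derive_fctX _ (is_derive_sinh r)).
have FTC : (\int[mu]_(r in I) (g r)%:E = 0)%E.
  have AB2 : A / 2 < B + 1 by lra.
  rewrite (@continuous_FTC2 _ g G)//.
  - rewrite !G0 ?subee//; [lra| |lra|].
      by apply/negP => /andP[? ?]; lra.
    by apply/negP => /andP[? ?]; lra.
  - by apply: continuous_in_subspaceT => r; rewrite inE => /I0/cg.
  - have cG (r : R) : 0 < r -> G x @[x --> r] --> G r.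
      by move=> r0; exact: is_derive_continuous (dG r r0).
    split.
    + move=> r; rewrite in_itv/= => /andP[? _].
      by case: (dG r _) => //; lra.
    + by apply: cvg_at_right_filter; apply: cG; lra.
    + by apply: cvg_at_left_filter; apply: cG; lra.
  - move=> r; rewrite in_itv/= => /andP[? _].
    by rewrite derive1E (@derive_val _ _ _ _ _ _ _ (dG r _))//; lra.
have mI : measurable I by exact: measurable_itv.
rewrite -[leLHS]adde0 -FTC -integralD_EFin//; [|exact/intg/cs|exact: intg].
apply: le_integral => //.
- exact: integrableD (intg _ (cs _ c1)) (intg _ cg).
- exact/intg/cs.
- move=> r; rewrite inE => /I0 r0; rewrite /= -EFinD lee_fin.
  by have := gF r r0; rewrite mulrBl lerBrDl.
Qed.

End RayIntegral.

Section HyperbolicIntegral.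
Context {R : realType} (N : nat).
Local Notation mR := (measurableTypeR R).
Local Notation mu := (@lebesgue_measure R).
Local Notation sigma := (@surface_measure R N).
Implicit Types f g : 'rV[R]_N -> R.

Definition ray_integral f (t : N.-tuple mR) : \bar R :=
  (\int[mu]_(r in `]0%R, +oo[%classic)
     (f ((r : R) *: vec t) * sinh (r : R) ^+ N.-1)%R%:E)%E.

Definition polar_integrand f (p : mR * N.-tuple mR) : \bar R :=
  (f ((p.1 : R) *: vec p.2) * sinh (p.1 : R) ^+ N.-1)%R%:E.

Lemma polar_integrand_ge0 f p : (forall x, 0 <= f x) ->
  @polar_domain R N p -> (0 <= polar_integrand f p)%E.
Proof.
move=> f0 [/= + _]; rewrite in_itv/= andbT => r0.
by rewrite lee_fin mulr_ge0// exprn_ge0// ltW// sinh_gt0.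
Qed.

Lemma measurable_polar_integrand f : ray_measurable f ->
  measurable_fun (@polar_domain R N) (polar_integrand f).
Proof.
move=> mf; apply/measurable_EFinP; apply: measurable_funM => //.
apply: measurable_funX.
apply: (@measurable_comp _ _ _ _ _ _ setT (sinh : mR -> mR) _ fst) => //.
  by apply: continuous_measurable_fun => r; exact: is_derive_continuous (is_derive_sinh r).
exact: measurable_funTS measurable_fst.
Qed.

Lemma patch_polar_integrand_ge0 f : (forall x, 0 <= f x) ->
  forall p, (0 <= (polar_integrand f \_ (@polar_domain R N)) p)%E.
Proof. by move=> f0 p; apply: erestrict_ge0 => q; exact: polar_integrand_ge0. Qed.

Lemma measurable_patch_polar_integrand f : ray_measurable f ->
  measurable_fun setT (polar_integrand f \_ (@polar_domain R N)).
Proof.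
move=> mf; apply/(measurable_restrictT _ _).1 => //.
  exact: measurable_polar_domain.
exact: measurable_polar_integrand.
Qed.

(** Tonelli's theorem, with the integrand extended by 0 off the domain of polar
    coordinates. *)
Lemma hyperbolic_integral_polar f : ray_measurable f -> (forall x, 0 <= f x) ->
  (hyperbolic_integral f = \int[sigma]_t \int[mu]_r
     (polar_integrand f \_ (@polar_domain R N)) (r, t))%E.
Proof.
move=> mf f0; rewrite /hyperbolic_integral integral_mkcond.
rewrite -fubini_tonelli2//.
  exact: measurable_patch_polar_integrand.
exact: patch_polar_integrand_ge0.
Qed.

Lemma ray_integralE f (t : N.-tuple mR) :
  (\int[mu]_r (polar_integrand f \_ (@polar_domain R N)) (r, t) =
   if polar_radius (vec t) == 1%R then ray_integral f t else 0)%E.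
Proof.
case: eqP => [t1|t1].
  rewrite /ray_integral [RHS]integral_mkcond; apply: eq_integral => r _.
  rewrite /patch; congr (if _ then _ else _).
  apply/idP/idP; rewrite !inE; first by case.
  by move=> r0; split.
rewrite integral0_eq// => r _; rewrite /patch; case: ifPn => //.
by rewrite inE => -[].
Qed.

Lemma hyperbolic_integral_le f g : ray_measurable f -> ray_measurable g ->
  (forall x, 0 <= f x) -> (forall x, 0 <= g x) ->
  (forall t, polar_radius (vec t) = 1 -> (ray_integral f t <= ray_integral g t)%E) ->
  (hyperbolic_integral f <= hyperbolic_integral g)%E.
Proof.
move=> mf mg f0 g0 fg; rewrite !hyperbolic_integral_polar//.
apply: ge0_le_integral => //.
- move=> t _; apply: integral_ge0 => r _; exact: patch_polar_integrand_ge0.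
- apply: measurable_fun_fubini_tonelli_G; last exact: patch_polar_integrand_ge0.
  exact: measurable_patch_polar_integrand.
- apply: measurable_fun_fubini_tonelli_G; last exact: patch_polar_integrand_ge0.
  exact: measurable_patch_polar_integrand.
- by move=> t _; rewrite !ray_integralE; case: eqP => // /fg.
Qed.

(** Each ray integral is at most the integral of a constant over a bounded
    interval, and the sphere has finite measure. *)
Lemma hyperbolic_integral_lty (A B : R) f : 0 < A -> A <= B ->
  ray_smooth A B 1 f -> ray_vanish A B f ->
  (forall x, 0 <= f x) -> (hyperbolic_integral f < +oo)%E.
Proof.
move=> A0 AB sf vf f0; have [[mf [M fM]] [f1 df _]] := sf; rewrite hyperbolic_integral_polar//.
pose K : R := Num.max M 0 * sinh (B + 1) ^+ N.-1 * ((B + 1) - A / 2).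
have B0 : 0 < B + 1 by lra.
have sB0 := sinh_gt0 B0.
have K0 : 0 <= K.
  apply: mulr_ge0; last by lra.
  by rewrite mulr_ge0 ?exprn_ge0 ?(ltW sB0)// le_max lexx orbT.
have bound t : (\int[mu]_r (polar_integrand f \_ (@polar_domain R N)) (r, t) <= K%:E)%E.
  rewrite ray_integralE; case: eqP => [t1|_]; last by rewrite lee_fin.
  rewrite /ray_integral (@integral_ray_restrict _ N A B A0 (fun r => f (r *: vec t))); last first.
    by move=> r r0 rAB; exact: vf.
  have Kcst : (\int[mu]_(r in `[(A / 2)%R, (B + 1)%R]%classic)
      (Num.max M 0 * sinh (B + 1) ^+ N.-1)%R%:E = K%:E)%E.
    rewrite integral_cst//= lebesgue_measure_itv/= lte_fin ifT; last by lra.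
    by rewrite -EFinD -EFinM.
  rewrite -Kcst; apply: ge0_le_integral => //.
  - move=> r; rewrite /= in_itv/= => /andP[Ar _].
    by rewrite lee_fin mulr_ge0// exprn_ge0// ltW// sinh_gt0//; lra.
  - apply/measurable_EFinP; apply: measurable_funM.
      apply: subspace_continuous_measurable_fun => //.
      apply: continuous_in_subspaceT => r; rewrite inE/= in_itv/= => /andP[Ar _].
      have r0 : 0 < r by lra.
      exact: is_derive_continuous (df _ _ t1 r0).
    apply: measurable_funX; apply: measurable_funTS; apply: continuous_measurable_fun => r.
    exact: is_derive_continuous (is_derive_sinh r).
  - move=> r; rewrite /= in_itv/= => /andP[Ar rB].
    have r0 : 0 < r by lra.
    have sr0 := ltW (sinh_gt0 r0).
    rewrite lee_fin; apply: ler_pM => //; first exact: exprn_ge0.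
      have [rAB|rAB] := boolP (A <= r <= B); last by rewrite vf// le_max lexx orbT.
      by rewrite le_max (le_trans (ler_norm _) (fM _ _ t1 rAB)).
    apply: lerXn2r; rewrite ?nnegrE ?(ltW sB0)//.
    by rewrite ler_pM2r ?invr_gt0// lerB// ler_expR ?lerN2.
apply: (@le_lt_trans _ _ (\int[sigma]_t K%:E)%E).
  apply: ge0_le_integral => //.
  - move=> t _; apply: integral_ge0 => r _; exact: patch_polar_integrand_ge0.
  - apply: measurable_fun_fubini_tonelli_G; last exact: patch_polar_integrand_ge0.
    exact: measurable_patch_polar_integrand.
rewrite integral_cst// lte_mul_pinfty ?lee_fin//.
exact: surface_measure_lty.
Qed.

End HyperbolicIntegral.

Section HyperbolicIntegralLinear.
Context {R : realType} (N : nat).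
Implicit Types f g : 'rV[R]_N -> R.

Lemma hyperbolic_integralD f g : ray_measurable f -> ray_measurable g ->
  (forall x, 0 <= f x) -> (forall x, 0 <= g x) ->
  (hyperbolic_integral (fun x => f x + g x)%R =
   hyperbolic_integral f + hyperbolic_integral g)%E.
Proof.
move=> mf mg f0 g0; rewrite /hyperbolic_integral -ge0_integralD//.
- by apply: eq_integral => p _; rewrite mulrDl EFinD.
- exact: measurable_polar_domain.
- by move=> p; exact: polar_integrand_ge0.
- exact: measurable_polar_integrand.
- by move=> p; exact: polar_integrand_ge0.
- exact: measurable_polar_integrand.
Qed.

Lemma hyperbolic_integralZ (c : R) f : 0 <= c -> ray_measurable f ->
  (forall x, 0 <= f x) ->
  (hyperbolic_integral (fun x => c * f x)%R = c%:E * hyperbolic_integral f)%E.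
Proof.
move=> c0 mf f0; rewrite /hyperbolic_integral -ge0_integralZl_EFin//.
- by apply: eq_integral => p _; rewrite -mulrA EFinM.
- exact: measurable_polar_domain.
- by move=> p; exact: polar_integrand_ge0.
- exact: measurable_polar_integrand.
Qed.

Lemma hyperbolic_integral_ge0 f : (forall x, 0 <= f x) -> (0 <= hyperbolic_integral f)%E.
Proof. by move=> f0; apply: integral_ge0 => p; exact: polar_integrand_ge0. Qed.

Lemma hyperbolic_integral_sum (I : eqType) (s : seq I) (F : I -> 'rV[R]_N -> R) :
  (forall i, ray_measurable (F i)) -> {in s, forall i x, 0 <= F i x} ->
  (hyperbolic_integral (fun x => \sum_(i <- s) F i x)%R =
   \sum_(i <- s) hyperbolic_integral (F i))%E.
Proof.
move=> mF; elim: s => [|i s IH] F0.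
  rewrite big_nil /hyperbolic_integral integral0_eq// => p _.
  by rewrite big_nil mul0r.
have Fs0 : {in s, forall i x, 0 <= F i x}.
  by move=> j js; apply: F0; rewrite in_cons js orbT.
have mS : ray_measurable (fun x => \sum_(j <- s) F j x).
  by apply: measurable_sum => j; exact: mF.
rewrite big_cons -IH// -hyperbolic_integralD//.
- by congr hyperbolic_integral; apply/funext => x; rewrite big_cons.
- by move=> x; apply: F0; exact: mem_head.
- by move=> x; rewrite big_seq sumr_ge0// => j js; exact: Fs0.
Qed.

End HyperbolicIntegralLinear.

(** * The Hardy-Rellich inequality *)

Section HardyFunction.
Context {R : realType} (N : nat) (C : nat -> R) (c : R) (h k : nat) (u : 'rV[R]_N -> R).

Definition hardy_term (i : nat) (x : 'rV[R]_N) : R := u x ^+ 2 / polar_radius x ^+ (2 * i).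

(** The terms with a minus sign are moved to the other side, so that only
    integrals of nonnegative functions are compared; finiteness of the integral
    of (L^h u)^2 is needed only to move it back. *)
Definition hardy_function (x : 'rV[R]_N) : R :=
  c * iter h radial_laplacian u x ^+ 2
  + \sum_(i <- index_iota 1 k.+1) C i * hardy_term i x.

Lemma hardy_term_ge0 i x : 0 <= hardy_term i x.
Proof. by rewrite mulr_ge0 ?sqr_ge0// invr_ge0 exprn_ge0// polar_radius_ge0. Qed.

Hypothesis C0 : forall i, (1 <= i <= k)%N -> 0 < C i.
Hypothesis c0 : 0 <= c.

Lemma hardy_function_ge0 x : 0 <= hardy_function x.
Proof.
apply: addr_ge0; first by rewrite mulr_ge0// sqr_ge0.
rewrite big_seq sumr_ge0// => i.
by rewrite mem_index_iota => ik; rewrite mulr_ge0 ?hardy_term_ge0// ltW// C0.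
Qed.

Variables (A B : R).
Hypothesis A0 : 0 < A.
Hypothesis su : smooth u.

Lemma ray_smooth_hardy_term n i : ray_smooth A B n (hardy_term i).
Proof.
have s1 := ray_smoothX A0 2 (@ray_smooth_smooth _ _ A B A0 n _ su).
have s2 := ray_smoothX A0 (2 * i) (@ray_smooth_inv_radius _ N A B A0 n).
apply: (ray_smooth_ext A0 _ (ray_smoothM s1 s2)) => w r _ _ /=.
by rewrite exprVn.
Qed.

Lemma ray_smooth_hardy_function n : ray_smooth A B n hardy_function.
Proof.
apply: ray_smoothD => //.
  apply: ray_smoothM => //; first exact: ray_smooth_cst.
  exact/ray_smoothX/ray_smooth_iter_laplacian.
apply: ray_smooth_sum => // i; apply: ray_smoothM => //; first exact: ray_smooth_cst.
exact: ray_smooth_hardy_term.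
Qed.

Lemma hyperbolic_integral_hardy_function :
  (hyperbolic_integral hardy_function =
   c%:E * hyperbolic_integral (fun x => iter h radial_laplacian u x ^+ 2)%R
   + \sum_(i <- index_iota 1 k.+1) (C i)%:E * hyperbolic_integral (hardy_term i))%E.
Proof.
have m1 : ray_measurable (fun x => iter h radial_laplacian u x ^+ 2).
  apply: (@ray_smooth_measurable _ _ A B 0).
  exact/ray_smoothX/ray_smooth_iter_laplacian.
have mt i : ray_measurable (hardy_term i) := ray_smooth_measurable (ray_smooth_hardy_term 0 i).
have Q0 x : 0 <= iter h radial_laplacian u x ^+ 2 by exact: sqr_ge0.
have mZ (d : R) (f : 'rV[R]_N -> R) : ray_measurable f -> ray_measurable (fun x => d * f x).
  by move=> mf; exact: measurable_funM.
have ms : ray_measurable (fun x => \sum_(i <- index_iota 1 k.+1) C i * hardy_term i x).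
  apply: (@ray_smooth_measurable _ _ A B 0); apply: ray_smooth_sum => // i.
  by apply: ray_smoothM => //; [exact: ray_smooth_cst|exact: ray_smooth_hardy_term].
have Ct0 : {in index_iota 1 k.+1, forall i x, 0 <= C i * hardy_term i x}.
  by move=> i; rewrite mem_index_iota => ik x; rewrite mulr_ge0 ?hardy_term_ge0// ltW// C0.
rewrite hyperbolic_integralD//; last 3 first.
- exact: mZ.
- by move=> x; rewrite mulr_ge0.
- by move=> x; rewrite big_seq sumr_ge0// => i ik; exact: Ct0.
rewrite hyperbolic_integralZ// hyperbolic_integral_sum//; last by move=> i; exact: mZ.
congr (_ + _)%E; rewrite big_seq [RHS]big_seq; apply: eq_bigr => i.
rewrite mem_index_iota => ik; rewrite hyperbolic_integralZ//; first exact/ltW/C0.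
exact: hardy_term_ge0.
Qed.

End HardyFunction.

Theorem theorem4p3 (R : realType) (N k l m h : nat)
    (hk : k = (2 * m + 1)%N) (hl : l = (2 * h)%N)
    (hlk : (l < k)%N) (hN : (2 * k < N)%N) :
  exists C : nat -> R,
    [/\ forall i : nat, (1 <= i <= k)%N -> 0 < C i,
        C k = C_top N (k - l) * Xi_zero N (2 * (k - l))%:R (l %/ 2),
        C 1%N = C_one N (k - l) * Xi_top N 2 (l %/ 2)
      & forall u : 'rV[R]_N -> R, test_function u ->
          (\sum_(1 <= i < k.+1)
              (C i)%:E *
              hyperbolic_integral (fun x => (u x ^+ 2 / polar_radius x ^+ (2 * i))%R)
           <= hyperbolic_integral
                (radial_gradient_sq (iter m radial_laplacian u))
              - (((N%:R - 1) / 2) ^+ (4 * (m - h) + 2))%R%:E *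
                hyperbolic_integral
                  (fun x => (iter h radial_laplacian u x ^+ 2)%R))%E].
Proof.
set p := (m - h)%N.
have N2 : (2 < N)%N by lia.
have kE : k = (2 * p + 1 + 2 * h)%N by rewrite /p; lia.
have klE : (k - l = 2 * p + 1)%N by lia.
have lE : (l %/ 2 = h)%N by rewrite hl mulKn.
have mE : m = (h + p)%N by rewrite /p; lia.
have phN : (2 * (2 * p + 1) + 4 * h < N)%N by lia.
pose C := @hardy_coef R N p h.
have C0 i : (1 <= i <= k)%N -> 0 < C i by rewrite kE; exact: hardy_coef_gt0.
exists C; split => //.
- by rewrite klE lE /C kE hardy_coef_top.
- by rewrite klE lE /C hardy_coef_bot.
move=> u tu; have [A [B [A0 AB uv]]] := test_function_annulus tu.
have su : smooth u by case: tu.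
set c : R := ((N%:R - 1) / 2) ^+ (4 * p + 2).
have c0 : 0 <= c by rewrite exprn_even_ge0//; lia.
have sV n j : ray_smooth A B n (iter j radial_laplacian u) := ray_smooth_iter_laplacian B A0 n j su.
have vV j : ray_vanish A B (iter j radial_laplacian u) := ray_vanish_iter_laplacian j uv.
have sV1 n j := ray_smooth_radial_derivative A0 (sV n.+1 j).
have sV2 n j := ray_smooth_radial_derivative A0 (sV1 n.+1 j).
have sG : ray_smooth A B 1 (radial_gradient_sq (iter m radial_laplacian u)).
  exact: (ray_smoothX A0 2 (sV1 1%N m)).
have sW : ray_smooth A B 1 (hardy_function C c h k u).
  exact: ray_smooth_hardy_function.
have main : (hyperbolic_integral (hardy_function C c h k u) <=
    hyperbolic_integral (radial_gradient_sq (iter m radial_laplacian u)))%E.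
  apply: hyperbolic_integral_le.
  - exact: ray_smooth_measurable sW.
  - exact: ray_smooth_measurable sG.
  - exact: hardy_function_ge0.
  - by move=> x; exact: sqr_ge0.
  move=> t t1; apply: (@integral_nonneg_up_to_exact _ N A B A0 AB
    (fun r => hardy_function C c h k u (r *: vec t))
    (fun r => radial_gradient_sq (iter m radial_laplacian u) (r *: vec t))).
  - by move=> r r0; exact: ray_smooth_continuous sW _ _.
  - by move=> r r0; exact: ray_smooth_continuous sG _ _.
  - move=> r r0 rAB; rewrite /hardy_function vV// expr0n mulr0 add0r big1// => i _.
    by rewrite /hardy_term uv// expr0n mul0r mulr0.
  - move=> r r0 rAB; rewrite /radial_gradient_sq.
    by rewrite (ray_vanish_radial_derivative (vV m))// expr0n.
  have ray := @ray_inequality R N N2 A B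
    (fun j r => iter j radial_laplacian u (r *: vec t))
    (fun j r => radial_derivative (iter j radial_laplacian u) (r *: vec t))
    (fun j r => radial_derivative (radial_derivative (iter j radial_laplacian u)) (r *: vec t))
    (fun j r r0 => is_derive_radial_derivative (sV 1%N j) t1 r0)
    (fun j r r0 => is_derive_radial_derivative (sV1 1%N j) t1 r0).
  apply: nonneg_up_to_exact_ge (ray _ _ _ p h phN).
  - move=> r r0; rewrite -mE le_eqVlt; apply/orP; left; apply/eqP; congr (_ - (_ + _)).
    rewrite -kE; apply: eq_bigr => i _; rewrite /hardy_term polar_radius_ray//.
    by rewrite exprVn mulrA mulrAC.
  - by move=> j r r0; case: (is_derive_radial_derivative (sV2 1%N j) t1 r0).
  - by move=> j r r0 rAB; exact: vV.
  - by move=> j r r0; rewrite /profile_laplacian iterS /radial_laplacian polar_radius_ray.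
have subtract (x y z : \bar R) : z \is a fin_num -> (x + z <= y -> x <= y - z)%E.
  by move=> zfin; rewrite leeBrDr.
apply: subtract; last first.
  by move: main; rewrite (hyperbolic_integral_hardy_function h C0 c0 B A0 su) addeC.
apply: fin_numM => //; rewrite ge0_fin_numE; last first.
  by apply: hyperbolic_integral_ge0 => x; exact: sqr_ge0.
apply: (hyperbolic_integral_lty A0 AB); last by move=> x; exact: sqr_ge0.
  exact: (ray_smoothX A0 2 (sV 1%N h)).
by move=> w r w1 r0 rAB; rewrite vV// expr0n.
Qed.
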